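(* Let $\mathbf{e}_q$ be an exponential time with parameter $q>0$, independent of $(X,\mathbb{P})$. Then for any $x\in\mathcal{H}$ and $t>0$, $$\lim_{q\to0}\mathbb{P}_x(\Lambda,\,t<\mathbf{e}_q\mid T_0>\mathbf{e}_q)=\mathbb{P}_x^\updownarrow(\Lambda),\qquad \forall\,\Lambda\in\mathcal{F}_t.$$
   Context: $X=(X_t)_{t\ge0}$ is the coordinate process on the space of càdlàg paths $\omega:[0,\infty)\to\mathbb{R}\cup\{\Delta\}$ ($\Delta$ a cemetery point), with completed right-continuous filtration $(\mathcal{F}_t)_{t\ge0}$; under $\mathbb{P}=\mathbb{P}_0$ it is a real-valued Lévy process started at $0$, and $\mathbb{P}_x$ is the law of $X+x$ under $\mathbb{P}$. The characteristic exponent $\psi$ is defined by $\mathbb{E}[e^{i\lambda X_t}]=e^{-t\psi(\lambda)}$. Standing assumptions: (1) $0$ is regular for itself under $\mathbb{P}$; (2) $(X,\mathbb{P})$ is not a compound Poisson process; (3) $\int_{\mathbb{R}}\frac{d\lambda}{q+\mathrm{Re}(\psi(\lambda))}<\infty$ for all $q>0$; (4) $\int_{\mathbb{R}}\left|\mathrm{Re}\left(\frac{1-e^{i\lambda}}{\psi(\lambda)}\right)\right|d\lambda<\infty$. For $q>0$, $u_q$ is the continuous function such that $\mathbb{E}_x\left[\int_0^\infty e^{-qt}f(X_t)dt\right]=\int_{\mathbb{R}}u_q(y-x)f(y)dy$ for bounded Borel $f$. $T_0=\inf\{t>0:X_t=0\}$. $h(x)=\lim_{q\to0}[u_q(0)-u_q(-x)]$,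 $x\in\mathbb{R}$; this limit exists and is finite and nonnegative, and $\mathbb{E}_x[h(X_t),t<T_0]=h(x)$ for all $t>0$, $x\in\mathbb{R}$. Put $\mathcal{H}=\{x\in\mathbb{R}:h(x)>0\}$. For $x\in\mathcal{H}$, $\mathbb{P}_x^\updownarrow$ is the unique probability measure such that for all $t\ge0$ and $\Lambda\in\mathcal{F}_t$, $$\mathbb{P}_x^\updownarrow(\Lambda)=\frac{1}{h(x)}\mathbb{E}_x\left(\mathbf{1}_\Lambda h(X_t)\mathbf{1}_{\{t<T_0\}}\right).$$ *)

(* Defs.v *)
From HB Require Import structures.
From mathcomp Require Import all_boot all_order all_algebra.
From mathcomp Require Import complex.
From mathcomp Require Import all_classical all_reals all_analysis.
From mathcomp Require Import measurable_realfun.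
Set Implicit Arguments.
Unset Strict Implicit.
Unset Printing Implicit Defensive.
Import Order.TTheory GRing.Theory Num.Theory.
Import numFieldTopology.Exports numFieldNormedType.Exports.

Local Open Scope classical_set_scope.
Local Open Scope ring_scope.

(* The state space R u {Delta} is [option R], with [None] for the cemetery
   point Delta, which is isolated.  A path on [0, +oo[ is represented by its
   extension to R that is constant on negative times. *)
Section paths.
Context {R : realType}.

Definition nbhs_state (a : option R) : set_system (option R) :=
  if a is Some x then Some @ nbhs x else [set A | A None].

Record is_cadlag (w : R -> option R) : Prop := IsCadlag {
  path_neg : forall s : R, s < 0 -> w s = w 0 ;
  path_rcont : forall t : R, w @ t^'+ `=>` nbhs_state (w t) ;
  path_llim : forall t : R, exists a, w @ t^'- `=>` nbhs_state a ;
  path_absorb : forall s t : R, s <= t -> w s = None -> w t = None }.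

Record cadlag := Cadlag { coord :> R -> option R ; coordP : is_cadlag coord }.

Lemma is_cadlag_dead : is_cadlag (fun=> None).
Proof.
have cvg_dead (F : set_system R) (FF : Filter F) :
    (fun=> None : option R) @ F `=>` nbhs_state None.
  move=> A /= AN; rewrite /nbhs /=.
  by apply: (@filterS _ F _ setT) => // *; exact: filterT.
split=> //.
- by move=> t; apply: cvg_dead.
- by move=> t; exists None; apply: cvg_dead.
Qed.

End paths.
Arguments cadlag : clear implicits.

HB.instance Definition _ (R : realType) := gen_eqMixin (cadlag R).
HB.instance Definition _ (R : realType) := gen_choiceMixin (cadlag R).
HB.instance Definition _ (R : realType) :=
  isPointed.Build (cadlag R) (Cadlag (@is_cadlag_dead R)).

Section canonical_space.
Context {R : realType}.

(* the event {X_t in B}, for B a set of real numbers *)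
Definition coord_in (t : R) (B : set R) : set (cadlag R) :=
  [set w | (Some @` B) (w t)].

Definition cylinders : set (set (cadlag R)) :=
  [set A | exists (t : R) (B : set R),
     [/\ 0 <= t, measurable B & A = coord_in t B]].

(* F_raw t = sigma(X_s, s <= t) and F_rawplus is its right limit *)
Definition F_raw (t : R) : set (set (cadlag R)) :=
  <<s [set A | exists (s : R) (B : set R),
         [/\ 0 <= s, s <= t, measurable B & A = coord_in s B]] >>.

Definition F_rawplus (t : R) : set (set (cadlag R)) :=
  \bigcap_(s in [set s | t < s]) F_raw s.

(* f(X_t), with the convention f(Delta) = 0 *)
Definition at_coord (f : R -> R) (t : R) (w : cadlag R) : R :=
  oapp f 0 (w t).

(* equal to +oo when 0 is never hit *)
Definition T_0 (w : cadlag R) : \bar R :=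
  ereal_inf (EFin @` [set t | 0 < t /\ w t = Some 0]).

End canonical_space.
Arguments cylinders : clear implicits.

Definition Omega (R : realType) := g_sigma_algebraType (cylinders R).
HB.instance Definition _ (R : realType) := Measurable.on (Omega R).

Section shift.
Context {R : realType}.

Lemma is_cadlag_shift (x : R) (w : cadlag R) :
  is_cadlag (fun t => omap (+%R^~ x) (w t)).
Proof.
have cvg_shift (F : set_system R) (FF : Filter F) a :
    coord w @ F `=>` nbhs_state a ->
    (fun t => omap (+%R^~ x) (w t)) @ F
      `=>` nbhs_state (omap (+%R^~ x) a).
  move=> wa A Aa.
  suff : nbhs_state a [set b | A (omap (+%R^~ x) b)] by move/wa.
  case: a Aa {wa} => [y|] //= Ay.
  have : (fun z : R => z + x) @ y --> y + x.
    by apply: cvgD => //; exact: cvg_cst.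
  by move=> /(_ _ Ay).
split.
- by move=> s s0; rewrite (path_neg (coordP w)).
- by move=> t; apply: cvg_shift; exact: path_rcont (coordP w) t.
- move=> t; have [a wa] := path_llim (coordP w) t.
  by exists (omap (+%R^~ x) a); exact: cvg_shift.
- move=> s t st; case ws: (w s) => [//|] _.
  by rewrite (path_absorb (coordP w) st ws).
Qed.

Definition shift_path (x : R) (w : Omega R) : Omega R :=
  Cadlag (is_cadlag_shift x w).

Lemma measurable_shift_path (x : R) : measurable_fun setT (shift_path x).
Proof.
apply: (@measurability _ _ (Omega R) (Omega R) setT (shift_path x)
  (cylinders R)) => //.
move=> _ [_ [t [B [t0 mB ->]]] <-]; apply: sub_sigma_algebra.
exists t, ((fun y => y + x) @^-1` B); split=> //.
  rewrite -[X in measurable X]setTI.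
  suff : measurable_fun setT (fun y : R => y + x) by apply.
  exact: measurable_funD.
rewrite setTI; apply/seteqP; split=> w; rewrite /coord_in /shift_path /=.
  by case: (coord w t) => [y|] [z Bz] //= [] zy; exists y => //=; rewrite -zy.
by move=> [y By <-] /=; exists (y + x).
Qed.

HB.instance Definition _ (x : R) :=
  isMeasurableFun.Build _ _ (Omega R) (Omega R) (shift_path x)
    (measurable_shift_path x).

Definition Px (P : probability (Omega R) R) (x : R) : probability (Omega R) R :=
  distribution P (shift_path x).

End shift.

Section completion.
Context {R : realType} (P : probability (Omega R) R).

(* the path space with the completion of its sigma-algebra under P_x, and the
   extension of P_x to it *)
Definition cOmega (x : R) : measurableType _ :=
  caratheodory_type ((Px P x)^*)%mu.

Definition cPx (x : R) : {measure set (cOmega x) -> \bar R} :=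
  @completed_measure_extension _ _ _ (Px P x).

(* Each sigma-algebra F_rawplus t is completed under every P_x; the resulting
   filtration is still right-continuous.  Adjoining to it all the null sets of
   the sigma-algebra of the whole process, instead of those of F_rawplus t,
   would not be compatible with h-transforms: if P_x(T_0 < +oo) = 1, the event
   {T_0 = +oo} would belong to F_0 and be P_x-null, although the h-transform of
   P_x is carried by it. *)
Definition F_t (t : R) : set (set (cadlag R)) :=
  [set L | forall x, exists A B,
     [/\ F_rawplus t A, F_rawplus t B, A `<=` L, L `<=` B
       & Px P x (B `\` A) = 0%E]].

Definition F_infty :=
  g_sigma_algebraType (\bigcup_(t in [set t : R | 0 <= t]) F_t t).

End completion.

(* e^z for complex z, which the library does not provide *)
Definition cexp {R : realType} (z : R[i]) : R[i] :=
  Complex (expR (complex.Re z) * cos (complex.Im z))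
          (expR (complex.Re z) * sin (complex.Im z)).

Section levy.
Context {R : realType} (P : probability (Omega R) R).

Definition incr_in (s t : R) (B : set R) : set (cadlag R) :=
  [set w | exists x y, [/\ w s = Some x, w t = Some y & B (y - x)]].

(* regularity of the trajectories is part of the definition of [cadlag] *)
Record levy_process : Prop := LevyProcess {
  levy_real : {ae P, forall w : Omega R, forall t : R, 0 <= t -> w t <> None} ;
  levy_start : P (coord_in 0 [set 0]) = 1%E ;
  levy_indep : forall (s t : R) (A : set (cadlag R)) (B : set R),
    0 <= s -> s <= t -> F_raw s A -> measurable B ->
    P (A `&` incr_in s t B) = (P A * P (incr_in s t B))%E ;
  levy_stat : forall (s t : R) (B : set R), 0 <= s -> s <= t -> measurable B ->
    P (incr_in s t B) = P (incr_in 0 (t - s) B) }.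

Definition characteristic_exponent (psi : R -> R[i]) : Prop :=
  forall l t : R, 0 <= t ->
    Complex (\int[P]_w at_coord (fun y => cos (l * y)) t w)
            (\int[P]_w at_coord (fun y => sin (l * y)) t w)
    = cexp (- (Complex t 0 * psi l)).

Definition regular_for_itself : Prop :=
  cPx P 0 [set w | T_0 w = 0%E] = 1%E.

Record poisson_process (c : R) (N : R -> Omega R -> nat) : Prop :=
  PoissonProcess {
  poisson_meas : forall t : R, 0 <= t -> measurable_fun setT (N t) ;
  poisson_start : {ae P, forall w, N 0 w = 0%N} ;
  poisson_path : {ae P, forall w, forall t : R, 0 <= t ->
    (forall s : R, t <= s -> (N t w <= N s w)%N) /\
    \forall s \near t^'+, N s w = N t w} ;
  poisson_incr : forall (n : nat) (t : nat -> R) (k : nat -> nat),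
    t 0%N = 0 -> (forall i, t i < t i.+1) ->
    P (\bigcap_(i in `I_n) [set w | N (t i.+1) w = (N (t i) w + k i)%N])
    = (\prod_(i < n) poisson_pmf (c * (t i.+1 - t i)) (k i))%:E }.

(* X_t = xi_0 + ... + xi_(N_t - 1) for a Poisson process N with rate c and an
   i.i.d. sequence xi with common law nu, independent of N.  No auxiliary
   probability space is needed, since N and xi can be taken to be the counting
   process and the sequence of the (nonzero) jumps of X. *)
Definition compound_poisson_process : Prop :=
  exists (c : R) (nu : probability (measurableTypeR R) R)
         (N : R -> Omega R -> nat) (xi : nat -> Omega R -> R),
  [/\ 0 < c,
      poisson_process c N,
      forall k, measurable_fun setT (xi k),
      forall (m n : nat) (s : nat -> R) (j : nat -> nat) (B : nat -> set R),
        (forall i, 0 <= s i) -> (forall k, measurable (B k)) ->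
        let NE := \bigcap_(i in `I_m) [set w | N (s i) w = j i] in
        P (NE `&` \bigcap_(k in `I_n) (xi k @^-1` B k))
        = (P NE * (\prod_(k < n) fine (nu (B k)))%:E)%E &
      {ae P, forall w : Omega R, forall t : R, 0 <= t ->
        w t = Some (\sum_(k < N t w) xi k w)}].

(* u q is the continuous density of the q-resolvent *)
Definition resolvent_density (u : R -> R -> R) : Prop :=
  forall q : R, 0 < q ->
    continuous (u q) /\
    forall (f : R -> R) (x : R), measurable_fun setT f -> bounded_fun f ->
      (\int[Px P x]_w \int[lebesgue_measure]_(t in `[0%R, +oo[)
          (expR (- q * t) * at_coord f t w)%:E
       = \int[lebesgue_measure]_y (u q (y - x) * f y)%:E)%E.

(* Q is the h-transform of P_x by the kernel of X killed at T_0 *)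
Definition conditioned_law (h : R -> R) (x : R)
    (Q : probability (F_infty P) R) : Prop :=
  forall (t : R) (L : set (cadlag R)), 0 <= t -> F_t P t L ->
    Q L = (((h x)^-1)%:E *
      \int[cPx P x]_w
        (\1_L w * at_coord h t w * \1_[set w' | (t%:E < T_0 w')%E] w)%:E)%E.

End levy.

Definition cond_prob {R : realType} {T : Type} (mu : set T -> \bar R)
  (A B : set T) : R := fine (mu (A `&` B)) / fine (mu B).

(* Main.v *)
Require Import Defs.
From HB Require Import structures.
From mathcomp Require Import all_boot all_order all_algebra.
From mathcomp Require Import complex.
From mathcomp Require Import all_classical all_reals all_analysis.
From mathcomp Require Import measurable_realfun.
From mathcomp Require Import ring lra.
Set Implicit Arguments.
Unset Strict Implicit.
Unset Printing Implicit Defensive.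
Import Order.TTheory GRing.Theory Num.Theory.
Import numFieldTopology.Exports numFieldNormedType.Exports.
Local Open Scope classical_set_scope.
Local Open Scope ring_scope.

(** Let H_q y = u_q 0 - u_q (-y), which tends to h y as q tends to 0.  Writing
    T_0 for the first zero and e_q for the exponential clock, the conditional
    probability in question has the closed form

      P_x (L, t < e_q | e_q < T_0) = e^(-qt) E_x [H_q (X_t); L, t < T_0] / H_q x

    (lemma [cond_prob_excess]).  As q tends to 0 the integrand tends to h (X_t)
    and is nonnegative, so Fatou's argument bounds the lower limit of the
    quotient below by E_x [h (X_t); L, t < T_0] / h x, the mass that the
    h-transform gives to L.  The same holds for the complement of L.  The two
    lower bounds add up to 1, because the h-transform is a probability measure,
    while the two quotients add up to at most 1 ([excess_le]); hence both
    converge.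

    The closed form rests on a conditional version of the identity
    E_y [e^(-q T_0)] = u_q (-y) / u_q 0, namely [hitting_identity]: for an event
    A of the right-continuous past of t,

      E_x [e^(-qt) u_q (-X_t); A] = u_q 0 E_x [e^(-qT); A],

    where T is the limit of the hitting times T_n, after t, of the intervals
    |y| < 1/(n+1).  To see it, compare the time that X spends in the n-th
    interval after t with the time that it spends there after T_n: they are
    equal.  By the strong Markov property at t and at T_n, the expectations of
    both (discounted at rate q) are integrals of the resolvent of the interval,
    evaluated at X_t and at X_(T_n).  Divided by 2q/(n+1), this resolvent is an
    average of the density u_q; it tends to u_q (-X_t) in the first case and, as
    X_(T_n) tends to 0, to u_q 0 in the second.

    It remains to see that T is the first zero, which amounts to X_T = 0
    almost surely ([X_hit_limit]).  For t = 0 and y different from 0, the path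
    stays away from 0 for some time, so that T > 0 and the identity gives
    u_q (-y) < u_q 0 ([v_lt0]).  On the other hand, comparing the strong Markov
    property at T with the limit of the strong Markov properties at T_n gives
    E_x [e^(-qT) (u_q 0 - u_q (-X_T))] = 0.  Both facts together force X_T = 0
    wherever T is finite.

    The strong Markov property ([strong_markov]) is proved for the discounted
    occupation of a set, by approximating a stopping time from above along a
    grid and applying the Markov property at the points of the grid. *)

(** * Integration and the exponential density *)

Section bounded_convergence.
Context d (T : measurableType d) (R : realType) (mu : probability T R).

Lemma bounded_cvg (A : set T) (f_ : (T -> R)^nat) (f : T -> R) (M : R) :
  measurable A ->
  (forall n, measurable_fun A (f_ n)) ->
  (forall w, A w -> f_ n w @[n --> \oo] --> f w) ->
  (forall n w, A w -> `|f_ n w| <= M) ->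
  (\int[mu]_(w in A) (f_ n w)%:E @[n --> \oo] --> \int[mu]_(w in A) (f w)%:E)%E.
Proof.
move=> mA mf ff fM.
apply: (@dominated_cvg _ _ _ mu A mA _ _ (fun=> M%:E)).
- by move=> n; exact/measurable_EFinP.
- by move=> w Aw; apply: cvg_EFin; [exact: nearW|exact: ff].
- by [].
- exact: (finite_measure_integrable_cst mu M mA).
- by move=> n w Aw; rewrite lee_fin fM.
Qed.

End bounded_convergence.

Section exponential_clock.
Context {R : realType}.
Notation leb := (@lebesgue_measure R).

Lemma lebesgue_measureD (r : R) (A : set R) : measurable A ->
  pushforward leb (+%R r : R -> measurableTypeR R) A = leb A.
Proof.
move=> mA; apply/esym/lebesgue_measure_unique => //=.
  exact: measurable_funD.
move=> mr _ [[a b]] _ <-; rewrite /pushforward.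
have -> : +%R r @^-1` `]a, b] = `]a - r, b - r]%classic.
  by apply/seteqP; split=> y /=; rewrite !in_itv/= ltrBlDl lerBrDl.
by rewrite !lebesgue_measure_itv/= !lte_fin ltrD2r; case: ifPn => // _;
  congr (_%:E); lra.
Qed.

Lemma ge0_integral_shift (r : R) (f : R -> \bar R) :
  measurable_fun setT f -> (forall y, 0 <= f y)%E ->
  (\int[leb]_y f y = \int[leb]_y f (r + y)%R)%E.
Proof.
move=> mf f0.
have mr : measurable_fun setT (+%R r : R -> measurableTypeR R).
  exact: measurable_funD.
transitivity (\int[pushforward leb (+%R r : R -> measurableTypeR R)]_y f y)%E.
  by apply: eq_measure_integral => A mA _; exact/esym/lebesgue_measureD.
by rewrite ge0_integral_pushforward.
Qed.

Lemma ge0_integral_eq_off (r : R) (f g : R -> \bar R) :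
  measurable_fun setT f -> measurable_fun setT g ->
  (forall y, 0 <= f y)%E -> (forall y, 0 <= g y)%E ->
  (forall y, y != r -> f y = g y) ->
  (\int[leb]_y f y = \int[leb]_y g y)%E.
Proof.
move=> mf mg f0 g0 fg; apply: ge0_ae_eq_integral => //.
exists [set r]; split => //; first exact: lebesgue_measure_set1.
by move=> y /= yr; apply: contrapT => /eqP nyr; apply: yr => _; exact: fg.
Qed.

(** The memoryless property of the exponential law, in terms of its density. *)
Lemma integral_exponential_pdf_shift (q r : R) (g : R -> R) : 0 < q -> 0 <= r ->
  measurable_fun setT g -> (forall y, 0 <= g y) ->
  (\int[leb]_s (exponential_pdf q s * ((r < s)%R%:R * g s))%:E =
   (expR (- q * r))%:E * \int[leb]_s (exponential_pdf q s * g (r + s))%:E)%E.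
Proof.
move=> q0 r0 mg g0.
have mpdf := measurable_exponential_pdf q.
have pdf0 s : 0 <= exponential_pdf q s by apply: exponential_pdf_ge0; exact: ltW.
have mlt : measurable_fun setT (fun s : R => (r < s)%R%:R : R).
  have -> : (fun s : R => (r < s)%R%:R : R) = \1_(`]r, +oo[%classic).
    by apply/funext => s; rewrite indicE mem_setE in_itv/= andbT.
  exact: measurable_indic.
have mle : measurable_fun setT (fun s : R => (r <= s)%R%:R : R).
  have -> : (fun s : R => (r <= s)%R%:R : R) = \1_(`[r, +oo[%classic).
    by apply/funext => s; rewrite indicE mem_setE in_itv/= andbT.
  exact: measurable_indic.
transitivity (\int[leb]_s (exponential_pdf q s * ((r <= s)%R%:R * g s))%:E)%E.
  apply: (@ge0_integral_eq_off r).
  - by apply/measurable_EFinP; do 2 apply: measurable_funM => //.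
  - by apply/measurable_EFinP; do 2 apply: measurable_funM => //.
  - by move=> y; rewrite lee_fin !mulr_ge0.
  - by move=> y; rewrite lee_fin !mulr_ge0.
  - by move=> y yr; rewrite [in RHS]le_eqVlt eq_sym (negbTE yr).
rewrite (ge0_integral_shift r); last 2 first.
- by apply/measurable_EFinP; do 2 apply: measurable_funM => //.
- by move=> y; rewrite lee_fin !mulr_ge0.
rewrite -ge0_integralZl//; last 2 first.
- apply/measurable_EFinP; apply: measurable_funM => //.
  by apply: measurableT_comp => //; exact: measurable_funD.
- by move=> y _; rewrite lee_fin mulr_ge0.
apply: eq_integral => s _; rewrite -EFinM; congr EFin.
rewrite lerDl; have [s0|s0] := leP 0 s; last first.
  by rewrite mul0r mulr0 lt0_exponential_pdf// mul0r mulr0.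
rewrite !exponential_pdfE//; last exact: addr_ge0.
by rewrite mulrDr expRD mul1r -!mulrA mulrCA.
Qed.

End exponential_clock.

(** * Approximation of a time from above *)

Section discretisation.
Context {R : realType}.

(** The points [grid_up n k] are spaced by 1/(n+1), and [grid_up n (grid n s)]
    is the first of them strictly after a nonnegative time s.  The strict
    inequality matters: it lets right limits of paths be taken along the grid,
    and it makes the event that a stopping time lies in a given cell belong to
    the past of the right end of the cell. *)
Definition grid (n : nat) (s : R) : nat := Num.truncn (s * n.+1%:R).
Definition grid_up (n : nat) (k : nat) : R := k.+1%:R / n.+1%:R.

Lemma lt_grid_up n s : s < grid_up n (grid n s).
Proof. by rewrite /grid_up ltr_pdivlMr ?ltr0n// truncnS_gt. Qed.

Lemma grid_up_gt0 n k : 0 < grid_up n k.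
Proof. by rewrite divr_gt0 ?ltr0n. Qed.

Lemma grid_up_le n s : 0 <= s -> grid_up n (grid n s) <= s + n.+1%:R^-1.
Proof.
move=> s0; rewrite /grid_up -natr1 mulrDl mul1r lerD2r ler_pdivrMr ?ltr0n//.
by rewrite /grid truncn_le mulr_ge0.
Qed.

Lemma gridE n s k : 0 <= s ->
  (grid n s == k) = (k%:R / n.+1%:R <= s < grid_up n k).
Proof.
move=> s0; rewrite /grid_up ler_pdivrMr ?ltr0n// ltr_pdivlMr ?ltr0n//.
by rewrite /grid truncn_eq// mulr_ge0.
Qed.

Lemma grid_up_cvg s : 0 <= s -> grid_up n (grid n s) @[n --> \oo] --> s.
Proof.
move=> s0.
apply: (@squeeze_cvgr _ _ _ _ (fun=> s) (fun n => s + n.+1%:R^-1)).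
- by apply: nearW => n; rewrite (ltW (lt_grid_up _ _)) grid_up_le.
- exact: cvg_cst.
- rewrite -[X in _ --> X]addr0; apply: cvgD; [exact: cvg_cst|].
  exact: (@cvg_harmonic R).
Qed.

Lemma grid_up_cvg_neg s : s < 0 -> grid_up n (grid n s) @[n --> \oo] --> (0 : R).
Proof.
move=> s0.
rewrite (_ : (fun n => _) = harmonic); first exact: (@cvg_harmonic R).
apply/funext => n; rewrite /grid_up /grid /= (_ : Num.truncn _ = 0%N) ?mul1r//.
apply/truncn0Pn; rewrite -ltNge (@lt_trans _ _ 0)//.
by rewrite pmulr_llt0.
Qed.

Lemma measurable_grid n k : measurable (grid n @^-1` [set k] : set R).
Proof.
rewrite (_ : _ @^-1` _ = if k == 0%N then `]-oo, grid_up n 0[%classic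
  else `[k%:R / n.+1%:R, grid_up n k[%classic); first by case: ifPn.
apply/seteqP; split=> s /=.
  move=> <-; case: ifPn => [/eqP k0|k0]; rewrite /= in_itv/=.
    by have := lt_grid_up n s; rewrite k0.
  rewrite lt_grid_up andbT ler_pdivrMr ?ltr0n// truncn_le.
  rewrite leNgt; apply/negP => s0; move/negP: k0; apply; apply/eqP.
  by apply/truncn0Pn; rewrite -ltNge (lt_trans s0).
case: ifPn => [/eqP ->|k0]; rewrite /= in_itv/=.
  move=> sn; apply/truncn0Pn; rewrite -ltNge.
  by move: sn; rewrite /grid_up ltr_pdivlMr ?ltr0n.
move=> /andP[ks sk]; apply/eqP; rewrite gridE ?ks ?sk//.
by apply: le_trans ks; rewrite divr_ge0.
Qed.

End discretisation.

(** * The coordinate process and its past *)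

Section paths.
Context {R : realType}.
Implicit Types (w : Omega R) (t s : R).

Definition X t w : R := at_coord idfun t w.

(** Continuity of f suffices although f is extended by 0 to the cemetery point,
    because that point is isolated. *)
Lemma right_continuous_at_coord (f : R -> R) w t : continuous f ->
  (fun s => at_coord f s w) @ t^'+ --> at_coord f t w.
Proof.
move=> cf A; rewrite /at_coord => Aw.
have := path_rcont (coordP w) (t := t).
move=> /(_ [set b | A (oapp f 0 b)]); apply.
by move: Aw; case: (Defs.coord w t) => [y Aw|] /=; [exact: cf|exact: nbhs_singleton].
Qed.

Lemma at_coord_neg (f : R -> R) w t : t < 0 -> at_coord f t w = at_coord f 0 w.
Proof. by move=> t0; rewrite /at_coord (path_neg (coordP w) t0). Qed.

Lemma at_coord_grid_cvg (f : R -> R) w t : continuous f ->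
  at_coord f (grid_up n (grid n t)) w @[n --> \oo] --> at_coord f t w.
Proof.
move=> cf; have [t0|t0] := leP 0 t.
  have /cvg_at_rightP := @right_continuous_at_coord f w t cf.
  by apply; split; [move=> n; exact: lt_grid_up|exact: grid_up_cvg].
rewrite (at_coord_neg _ _ t0).
have /cvg_at_rightP := @right_continuous_at_coord f w 0 cf.
by apply; split; [move=> n; exact: grid_up_gt0|exact: grid_up_cvg_neg].
Qed.

Lemma right_continuous_X w t : (fun s => X s w) @ t^'+ --> X t w.
Proof. by apply: right_continuous_at_coord => x; exact: cvg_id. Qed.

Lemma X_seq_right w t (s_ : R^nat) : (forall n, t < s_ n) ->
  s_ n @[n --> \oo] --> t -> X (s_ n) w @[n --> \oo] --> X t w.
Proof.
by move=> ts st; have /cvg_at_rightP := @right_continuous_X w t; apply.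
Qed.

(** Through this measurable type, the members of [F_raw t] inherit the closure
    properties of measurable sets. *)
Definition past (t : R) := g_sigma_algebraType
  [set A | exists (s : R) (B : set R),
         [/\ 0 <= s, s <= t, measurable B & A = @coord_in R s B]].

Lemma F_raw_past t (A : set (past t)) : F_raw t A = measurable A.
Proof. by []. Qed.

Lemma F_rawT t : F_raw t [set: cadlag R].
Proof. exact: (@measurableT _ (past t)). Qed.

Lemma F_raw0 t : F_raw t (@set0 (cadlag R)).
Proof. exact: (@measurable0 _ (past t)). Qed.

Lemma F_rawC t (A : set (cadlag R)) : F_raw t A -> F_raw t (~` A).
Proof. exact: (@measurableC _ (past t)). Qed.

Lemma F_rawI t (A B : set (cadlag R)) :
  F_raw t A -> F_raw t B -> F_raw t (A `&` B).
Proof. exact: (@measurableI _ (past t)). Qed.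

Lemma F_rawD t (A B : set (cadlag R)) :
  F_raw t A -> F_raw t B -> F_raw t (A `\` B).
Proof. exact: (@measurableD _ (past t)). Qed.

Lemma F_raw_bigcup t (A : (set (cadlag R))^nat) :
  (forall n, F_raw t (A n)) -> F_raw t (\bigcup_n A n).
Proof. exact: (@bigcupT_measurable _ (past t)). Qed.

Lemma F_raw_bigcap t (A : (set (cadlag R))^nat) :
  (forall n, F_raw t (A n)) -> F_raw t (\bigcap_n A n).
Proof. exact: (@bigcapT_measurable _ (past t)). Qed.

Lemma F_raw_le s t : s <= t -> @F_raw R s `<=` F_raw t.
Proof.
move=> st; apply: sub_sigma_algebra2 => A [r [B [r0 rs mB ->]]].
by exists r, B; split => //; exact: le_trans st.
Qed.

Lemma F_raw_measurable t (A : set (Omega R)) : F_raw t A -> measurable A.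
Proof.
move=> +; apply: sub_sigma_algebra2 => {}A [r [B [r0 rs mB ->]]].
by exists r, B.
Qed.

Lemma at_coord_preimage (f : R -> R) t (B : set R) :
  at_coord f t @^-1` B =
  coord_in t (f @^-1` B) `|` (if 0 \in B then ~` coord_in t setT else set0).
Proof.
rewrite /at_coord /coord_in; apply/seteqP; split=> w /=.
  case E : (Defs.coord w t) => [y|] /= By; first by left; exists y.
  by right; rewrite mem_set// => -[y _] /=; rewrite E.
case; first by move=> [y By <-].
case: ifPn => // /set_mem B0 /=; case: (Defs.coord w t) => [y|//] H /=.
by exfalso; apply: H; exists y.
Qed.

Lemma F_raw_at_coord (f : R -> R) s t (B : set R) : measurable_fun setT f ->
  0 <= s -> s <= t -> measurable B -> F_raw t (at_coord f s @^-1` B).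
Proof.
move=> mf s0 st mB; rewrite at_coord_preimage F_raw_past.
have mc (C : set R) : measurable C -> F_raw t (coord_in s C).
  by move=> mC; apply: sub_sigma_algebra; exists s, C.
apply: measurableU.
  by apply: mc; rewrite -[X in measurable X]setTI; exact: mf.
case: ifPn => _; last exact: measurable0.
by apply: measurableC; apply: mc; exact: measurableT.
Qed.

Lemma F_raw_X s t (B : set R) : 0 <= s -> s <= t -> measurable B ->
  F_raw t (X s @^-1` B).
Proof. by move=> s0 st mB; apply: F_raw_at_coord => //; exact: measurable_id. Qed.

Lemma measurable_at_coord (f : R -> R) t : measurable_fun setT f ->
  measurable_fun setT (at_coord f t : Omega R -> R).
Proof.
move=> mf; wlog t0 : t / 0 <= t => [H|].
  have [t0|t0] := leP 0 t; first exact: H.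
  rewrite (_ : at_coord f t = at_coord f 0); first exact: H.
  by apply/funext => w; exact: at_coord_neg.
move=> _ B mB; rewrite setTI; apply: (@F_raw_measurable t).
exact: F_raw_at_coord.
Qed.

(** Joint measurability in the path and in time, from right-continuity: the
    value at time s is the limit of the values at the grid points above s. *)
Lemma measurable_at_coord2 (f : R -> R) : continuous f ->
  measurable_fun setT (fun z : Omega R * R => at_coord f z.2 z.1).
Proof.
move=> cf; apply: (measurable_fun_cvg
  (h := fun n (z : Omega R * R) => at_coord f (grid_up n (grid n z.2)) z.1)).
  move=> n _ B mB; rewrite setTI.
  rewrite (_ : _ @^-1` B = \bigcup_k
    ((at_coord f (grid_up n k) @^-1` B) `*` (grid n @^-1` [set k]))).
    apply: bigcupT_measurable => k; apply: measurableX.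
      rewrite -[X in measurable X]setTI.
      by apply: measurable_at_coord => //; exact: continuous_measurable_fun.
    exact: measurable_grid.
  apply/seteqP; split => -[w s] /=.
    by move=> Bs; exists (grid n s).
  by move=> [k _ [/= + ->]].
by move=> [w s] _ /=; exact: at_coord_grid_cvg.
Qed.

Lemma measurable_X t : measurable_fun setT (X t : Omega R -> R).
Proof. by apply: measurable_at_coord; exact: measurable_id. Qed.

Lemma measurable_X2 :
  measurable_fun setT (fun z : Omega R * R => X z.2 z.1).
Proof. by apply: measurable_at_coord2 => x; exact: cvg_id. Qed.

End paths.

(** * The Markov property at a fixed time *)

Lemma ae_measure_eq d (T : measurableType d) (R : realType)
    (mu : {measure set T -> \bar R}) (A B : set T) :
  measurable A -> measurable B -> {ae mu, forall w, A w <-> B w} ->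
  mu A = mu B.
Proof.
move=> mA mB AB; rewrite -(setIT A) -(setIT B) -!integral_indic//.
apply: ge0_ae_eq_integral => //.
- exact/measurable_EFinP/measurable_indic.
- exact/measurable_EFinP/measurable_indic.
- apply: filterS AB => w AB _; congr EFin; rewrite !indicE.
  by congr (nat_of_bool _)%:R; apply/idP/idP => /set_mem /AB /mem_set.
Qed.

Section past_of_path.
Context {R : realType}.
Implicit Types (w : Omega R) (r s t : R).

Definition to_past r (w : Omega R) : past r := w.

Lemma measurable_to_past r : measurable_fun setT (to_past r).
Proof. by move=> _ A pA; rewrite setTI; exact: F_raw_measurable pA. Qed.

HB.instance Definition _ r :=
  isMeasurableFun.Build _ _ (Omega R) (past r) (to_past r)
    (@measurable_to_past r).

Lemma measurable_X_past r t : 0 <= t -> t <= r ->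
  measurable_fun setT (X t : past r -> R).
Proof. by move=> t0 tr _ B mB; rewrite setTI; exact: F_raw_X. Qed.

Lemma F_raw_shift (x : R) r (A : set (cadlag R)) : F_raw r A ->
  F_raw r (shift_path x @^-1` A).
Proof.
suff : measurable_fun setT (shift_path x : past r -> past r).
  by move=> + rA => /(_ measurableT _ rA); rewrite setTI.
apply: (@measurability _ _ (past r) (past r) setT (shift_path x)) => //.
move=> _ [_ [t [B [t0 tr mB ->]]] <-]; apply: sub_sigma_algebra.
exists t, ((fun y => y + x) @^-1` B); split=> //.
  rewrite -[X in measurable X]setTI.
  suff : measurable_fun setT (fun y : R => y + x) by apply.
  exact: measurable_funD.
rewrite setTI; apply/seteqP; split=> w; rewrite /coord_in /shift_path /=.
  by case: (Defs.coord w t) => [y|] [z Bz] //= [] zy; exists y => //=; rewrite -zy.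
by move=> [y By <-] /=; exists (y + x).
Qed.

Lemma measurable_coord_in t (B : set R) : 0 <= t -> measurable B ->
  measurable (coord_in t B : set (Omega R)).
Proof. by move=> t0 mB; apply: sub_sigma_algebra; exists t, B. Qed.

(** This set is measurable because a killed path stays in the cemetery point,
    so that integer times detect it.  Outside it, the real-valued process [X]
    carries the same information as the path. *)
Definition dead : set (Omega R) := [set w | exists2 t, 0 <= t & w t = None].

Lemma deadE : dead = \bigcup_n ~` coord_in n%:R setT.
Proof.
apply/seteqP; split=> w.
  move=> [t t0 wt]; exists (Num.truncn t).+1 => // -[y _] /=.
  by rewrite (path_absorb (coordP w) (ltW (truncnS_gt t)) wt).
move=> [n _ wn]; exists n%:R => //; move: wn; rewrite /coord_in /=.
by case: (Defs.coord w n%:R) => [y|//] H; exfalso; apply: H; exists y.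
Qed.

Lemma measurable_dead : measurable dead.
Proof.
rewrite deadE; apply: bigcupT_measurable => n; apply: measurableC.
exact: measurable_coord_in.
Qed.

Lemma alive_X w t : ~ dead w -> 0 <= t -> w t = Some (X t w).
Proof.
move=> nd t0; rewrite /X /at_coord; case E : (Defs.coord w t) => [y //|].
by exfalso; apply: nd; exists t.
Qed.

Lemma alive_X_shift x w t : ~ dead w -> 0 <= t ->
  X t (shift_path x w) = X t w + x.
Proof. by move=> nd t0; rewrite {1}/X /at_coord /= (alive_X nd t0). Qed.

End past_of_path.

Section markov.
Context {R : realType} (P : probability (Omega R) R) (P_levy : levy_process P).
Implicit Types (w : Omega R) (r s t x y : R).

Lemma P_dead : P dead = 0%E.
Proof.
apply: measure_negligible; first exact: measurable_dead.
apply: negligibleS (levy_real P_levy) => w [t t0 wt] /= H.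
exact: H t0 wt.
Qed.

Lemma Px_dead x : Px P x dead = 0%E.
Proof.
rewrite -P_dead /Px /distribution /pushforward; congr (P _).
apply/seteqP; split=> w [t t0] /= wt; exists t => //=; last by rewrite wt.
by move: wt; case: (Defs.coord w t).
Qed.

Lemma ae_alive x : {ae Px P x, forall w, ~ dead w}.
Proof.
exists dead; split; [exact: measurable_dead|exact: Px_dead|].
by move=> w /= /contrapT.
Qed.

Lemma ae_alive0 : {ae P, forall w, ~ dead w}.
Proof.
exists dead; split; [exact: measurable_dead|exact: P_dead|].
by move=> w /= /contrapT.
Qed.

Lemma ae_start0 : {ae P, forall w, X 0 w = 0}.
Proof.
have m0 : measurable (coord_in 0 [set 0] : set (Omega R)).
  exact: measurable_coord_in.
exists (~` coord_in 0 [set 0]); split; first exact: measurableC.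
  by rewrite probability_setC// (levy_start P_levy) subee.
by apply: subsetC => w [y -> /= E]; rewrite /X /at_coord -E.
Qed.

Lemma ae_start x : {ae Px P x, forall w, X 0 w = x}.
Proof.
have m0 : measurable (coord_in 0 [set x] : set (Omega R)).
  exact: measurable_coord_in.
have E : Px P x (coord_in 0 [set x]) = 1%E.
  rewrite -(levy_start P_levy) /Px /distribution /pushforward; congr (P _).
  apply/seteqP; split=> w; rewrite /coord_in /=.
    case: (Defs.coord w 0) => [y|] [z -> ] //= -[zy]; exists 0 => //.
    by congr Some; lra.
  by move=> [y -> <-] /=; exists x => //; rewrite add0r.
exists (~` coord_in 0 [set x]); split; first exact: measurableC.
  by rewrite probability_setC// E subee.
by apply: subsetC => w [y -> /= Ey]; rewrite /X /at_coord -Ey.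
Qed.

Lemma measurable_incr s t :
  measurable_fun setT (fun w : Omega R => X t w - X s w).
Proof. by apply: measurable_funB; exact: measurable_X. Qed.

Lemma incr_inE s t (B : set R) : incr_in s t B =
  coord_in s setT `&` coord_in t setT `&` ((fun w => X t w - X s w) @^-1` B).
Proof.
apply/seteqP; split=> w; rewrite /incr_in /coord_in /X /at_coord /=.
  by move=> [y [z [-> -> Bzy]]]; split => //; split; [exists y|exists z].
by move=> [[[y _ <-] [z _ <-]] /= Bzy]; exists y, z.
Qed.

Lemma measurable_incr_in s t (B : set R) : 0 <= s -> 0 <= t -> measurable B ->
  measurable (incr_in s t B : set (Omega R)).
Proof.
move=> s0 t0 mB; rewrite incr_inE; apply: measurableI.
  by apply: measurableI; exact: measurable_coord_in.
by rewrite -[X in measurable X]setTI; exact: measurable_incr.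
Qed.

Lemma incr_in_alive w s t (B : set R) : ~ dead w -> 0 <= s -> 0 <= t ->
  incr_in s t B w <-> B (X t w - X s w).
Proof.
move=> nd s0 t0; rewrite incr_inE; split=> [[]//|Bw]; split => //.
by split; rewrite /coord_in /= alive_X//; [exists (X s w)|exists (X t w)].
Qed.

(** Independence and stationarity of the increments pass from P to P_x because
    they do not see the starting point, and the past of a shifted path is the
    shifted past. *)
Lemma markov_indep x r s (A : set (cadlag R)) (B : set R) :
  0 <= r -> 0 <= s -> F_raw r A -> measurable B ->
  Px P x (A `&` [set w | B (X (r + s) w - X r w)]) =
  (Px P x A * P (X s @^-1` B))%E.
Proof.
move=> r0 s0 rA mB; have rs0 : 0 <= r + s by exact: addr_ge0.
have mshift (C : set (Omega R)) : measurable C ->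
    measurable (shift_path x @^-1` C).
  by move=> mC; rewrite -[X in measurable X]setTI; exact: measurable_shift_path.
have mincr : measurable [set w : Omega R | B (X (r + s) w - X r w)].
  by rewrite -[X in measurable X]setTI; exact: measurable_incr.
have mA := F_raw_measurable rA.
have rA' := F_raw_shift x rA.
rewrite /Px /distribution /pushforward.
transitivity (P ((shift_path x @^-1` A) `&` incr_in r (r + s) B)).
  apply: (@ae_measure_eq _ (Omega R) R P).
  - by apply: mshift; exact: measurableI.
  - by apply: measurableI; [exact: mshift|exact: measurable_incr_in].
  - apply: filterS ae_alive0 => w nd; rewrite -propeqE /=; congr (_ /\ _).
    rewrite propeqE (incr_in_alive _ nd)//= !alive_X_shift//.
    by rewrite opprD addrACA subrr addr0.
rewrite (levy_indep P_levy r0 _ rA' mB) ?lerDl//; congr (_ * _)%E.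
rewrite (levy_stat P_levy r0 _ mB) ?lerDl// addrAC subrr add0r.
apply: (@ae_measure_eq _ (Omega R) R P).
- exact: measurable_incr_in.
- by rewrite -[X in measurable X]setTI; exact: measurable_X.
- apply: filterS2 ae_alive0 ae_start0 => w nd X0.
  by rewrite incr_in_alive//= X0 subr0.
Qed.

End markov.

Section markov_kernel.
Context {R : realType} (P : probability (Omega R) R) (P_levy : levy_process P).
Implicit Types (w : Omega R) (r s t x y : R).

Definition past_incr r s (w : Omega R) : past r * R :=
  (to_past r w, X (r + s) w - X r w).

Lemma measurable_past_incr r s : measurable_fun setT (past_incr r s).
Proof.
apply: measurable_fun_pair; first exact: measurable_to_past.
exact: measurable_incr.
Qed.

HB.instance Definition _ r s :=
  isMeasurableFun.Build _ _ (Omega R) (past r * R)%type (past_incr r s)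
    (@measurable_past_incr r s).

HB.instance Definition _ s :=
  isMeasurableFun.Build _ _ (Omega R) R (X s) (@measurable_X R s).

(** The pair formed by the past up to r and by the next increment has the law
    of a product, since the two laws agree on rectangles by [markov_indep]. *)
Lemma markov_kernel x r s (E : set (past r * R)) : 0 <= r -> 0 <= s ->
  measurable E ->
  (Px P x (past_incr r s @^-1` E) =
   \int[Px P x]_w P [set w' | E (to_past r w, X s w')])%E.
Proof.
move=> r0 s0 mE.
(* the law of the path is carried to the smaller sigma-algebra of the past *)
pose m1 : probability (past r) R := distribution (Px P x) (to_past r).
pose m2 : probability R R := distribution P (X s).
pose m3 : probability (past r * R)%type R := distribution (Px P x) (past_incr r s).
transitivity ((m1 \x m2)%E E).
  rewrite -[LHS]/(m3 E); apply/esym; apply: product_measure_unique => //.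
  move=> A B mA mB; rewrite /m1 /m2 /m3 /distribution /pushforward /=.
  exact: (markov_indep P_levy x r0 s0 mA mB).
rewrite /product_measure1 ge0_integral_pushforward//.
- apply: eq_integral => w _ /=; rewrite /m2 /distribution /pushforward.
  by congr (P _); apply/seteqP; split=> w' /=; rewrite /xsection /= ?inE.
- exact: measurable_fun_xsection.
Qed.

End markov_kernel.

Section resolvent.
Context {R : realType} (P : probability (Omega R) R) (P_levy : levy_process P).
Implicit Types (w : Omega R) (r s t x y : R) (D : set R).
Notation leb := (@lebesgue_measure R).

(** The kernel is expressed through P alone, so that it is visibly measurable in
    the starting point. *)
Definition transition D s y : \bar R := P [set w | D (y + X s w)].

(** q times the q-resolvent of D, that is the probability, starting from y, of
    finding the process in D at an independent exponential time of rate q. *)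
Definition potential q D y : \bar R :=
  (\int[leb]_s ((exponential_pdf q s)%:E * transition D s y))%E.

Lemma measurable_transition2 D : measurable D ->
  measurable_fun setT (fun z : R * R => transition D z.2 z.1).
Proof.
move=> mD.
pose E : set ((R * R) * Omega R) := [set z | D (z.1.1 + X z.1.2 z.2)].
have mE : measurable E.
  rewrite -[X in measurable X]setTI.
  have : measurable_fun setT (fun z : (R * R) * Omega R => z.1.1 + X z.1.2 z.2).
    apply: measurable_funD.
      by apply: (@measurableT_comp _ _ _ _ _ _ fst) => //.
    apply: (@measurableT_comp _ _ _ _ _ _ (fun z : Omega R * R => X z.2 z.1) _
      (fun z : (R * R) * Omega R => (z.2, z.1.2))); first exact: measurable_X2.
    apply: measurable_fun_pair => //.
    exact: (@measurableT_comp _ _ _ _ _ _ snd).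
  by move=> /(_ measurableT _ mD).
rewrite (_ : (fun _ => _) = (P \o xsection E)).
  exact: measurable_fun_xsection.
apply/funext => -[y s] /=; rewrite /transition; congr (P _).
by apply/seteqP; split=> w' /=; rewrite /xsection /= ?inE.
Qed.

Lemma transition_ge0 D s y : (0 <= transition D s y)%E.
Proof. exact: measure_ge0. Qed.

Lemma measurable_potential q D : 0 < q -> measurable D ->
  measurable_fun setT (potential q D).
Proof.
move=> q0 mD.
pose f (z : R * R) := ((exponential_pdf q z.2)%:E * transition D z.2 z.1)%E.
rewrite (_ : potential q D = fubini_F leb f); last by [].
apply: measurable_fun_fubini_tonelli_F => //.
  apply: emeasurable_funM; last exact: measurable_transition2.
  apply/measurable_EFinP; apply: (@measurableT_comp _ _ _ _ _ _ (exponential_pdf q)) => //.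
  exact: measurable_exponential_pdf.
move=> z; apply: mule_ge0; last exact: transition_ge0.
by rewrite lee_fin exponential_pdf_ge0// ltW.
Qed.

Lemma markov_X x r s (A : set (cadlag R)) D : 0 <= r -> 0 <= s -> F_raw r A ->
  measurable D ->
  (Px P x (A `&` X (r + s) @^-1` D) =
   \int[Px P x]_w ((\1_A w)%:E * transition D s (X r w)))%E.
Proof.
move=> r0 s0 rA mD.
pose E : set (past r * R) := [set z | A z.1 /\ D (X r z.1 + z.2)].
have mE : measurable E.
  rewrite (_ : E = (A `*` setT) `&` [set z | D (X r z.1 + z.2)]); last first.
    by apply/seteqP; split=> z [/= Az Dz]; split => //; case: Az.
  apply: measurableI; first by apply: measurableX.
  have : measurable_fun setT (fun z : past r * R => X r z.1 + z.2).
    apply: measurable_funD => //.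
    apply: (@measurableT_comp _ _ _ _ _ _ (X r : past r -> R)) => //.
    exact: measurable_X_past.
  by move=> /(_ measurableT _ mD); rewrite setTI.
have := @markov_kernel _ _ P_levy x _ _ _ r0 s0 mE.
rewrite (_ : past_incr r s @^-1` E = A `&` X (r + s) @^-1` D); last first.
  have e w : X r w + (X (r + s) w - X r w) = X (r + s) w.
    by rewrite addrC subrK.
  by apply/seteqP; split=> w /=; rewrite /E /= e.
move=> ->; apply: eq_integral => w _; rewrite indicE.
have [Aw|Aw] := boolP (w \in A).
  rewrite mul1e /transition; congr (P _); apply/seteqP; split=> w' /=.
    by move=> [].
  by split => //; exact/set_mem.
rewrite mul0e (_ : [set _ | _] = set0) ?measure0//.
by apply/seteqP; split=> w' //= [/= Aw' _]; move/negP: Aw; apply; exact/mem_set.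
Qed.

Lemma measurable_indic_X D w : measurable D ->
  measurable_fun setT (fun s => \1_D (X s w) : R).
Proof.
move=> mD.
apply: (@measurableT_comp _ _ _ _ _ _ (\1_D : R -> R)) => //.
apply: (@measurableT_comp _ _ _ _ _ _ (fun z : Omega R * R => X z.2 z.1) _
    (fun s : R => (w, s))); first exact: measurable_X2.
exact: measurable_fun_pair.
Qed.

Lemma measurable_transition_X D r : measurable D ->
  measurable_fun setT (fun z : Omega R * R => transition D z.2 (X r z.1)).
Proof.
move=> mD.
apply: (@measurableT_comp _ _ _ _ _ _ (fun z : R * R => transition D z.2 z.1) _
  (fun z : Omega R * R => (X r z.1, z.2))); first exact: measurable_transition2.
by apply: measurable_fun_pair => //; apply: measurableT_comp.
Qed.

(** By the memoryless property, what happens after time r contributes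
    e^(-qr) times an integral over a process started at r, to which the Markov
    property at each single later time applies; Fubini's theorem exchanges the
    two integrals. *)
Lemma markov_resolvent q x r (A : set (cadlag R)) D : 0 < q -> 0 <= r ->
  F_raw r A -> measurable D ->
  (\int[Px P x]_w \int[leb]_s
     (\1_A w * (exponential_pdf q s * ((r < s)%R%:R * \1_D (X s w))))%:E =
   \int[Px P x]_w ((\1_A w * expR (- q * r))%:E * potential q D (X r w)))%E.
Proof.
move=> q0 r0 rA mD.
have mA := F_raw_measurable rA.
have mDX w := measurable_indic_X w mD.
have pdf0 s : 0 <= exponential_pdf q s by apply: exponential_pdf_ge0; exact: ltW.
have mAX s : measurable (A `&` X (r + s) @^-1` D : set (Omega R)).
  apply: measurableI => //; rewrite -[X in measurable X]setTI.
  exact: measurable_X.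
pose G (z : Omega R * R) : \bar R :=
  (\1_A z.1 * (exponential_pdf q z.2 * \1_D (X (r + z.2) z.1)))%:E.
have mG : measurable_fun setT G.
  apply/measurable_EFinP; apply: measurable_funM.
    apply: (@measurableT_comp _ _ _ _ _ _ (\1_A : Omega R -> R)) => //.
  apply: measurable_funM.
    apply: (@measurableT_comp _ _ _ _ _ _ (exponential_pdf q)) => //.
    exact: measurable_exponential_pdf.
  apply: (@measurableT_comp _ _ _ _ _ _ (\1_D : R -> R)) => //.
  apply: (@measurableT_comp _ _ _ _ _ _ (fun z : Omega R * R => X z.2 z.1) _
      (fun z : Omega R * R => (z.1, r + z.2))); first exact: measurable_X2.
  by apply: measurable_fun_pair => //; apply: measurable_funD.
have G0 z : (0 <= G z)%E by rewrite lee_fin !mulr_ge0.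
pose H (z : Omega R * R) : \bar R :=
  ((\1_A z.1)%:E * ((exponential_pdf q z.2)%:E * transition D z.2 (X r z.1)))%E.
have mH : measurable_fun setT H.
  apply: emeasurable_funM.
    apply/measurable_EFinP.
    by apply: (@measurableT_comp _ _ _ _ _ _ (\1_A : Omega R -> R)) => //.
  apply: emeasurable_funM; last exact: measurable_transition_X.
  apply/measurable_EFinP.
  apply: (@measurableT_comp _ _ _ _ _ _ (exponential_pdf q)) => //.
  exact: measurable_exponential_pdf.
have H0 z : (0 <= H z)%E.
  by rewrite !mule_ge0 ?lee_fin ?transition_ge0.
transitivity (\int[Px P x]_w ((expR (- q * r))%:E * \int[leb]_s G (w, s)))%E.
  apply: eq_integral => w _.
  under eq_integral do rewrite EFinM.
  rewrite ge0_integralZl//; last 2 first.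
  - apply/measurable_EFinP; apply: measurable_funM; first exact: measurable_exponential_pdf.
    apply: measurable_funM; last exact: mDX.
    have -> : (fun s : R => (r < s)%R%:R : R) = \1_(`]r, +oo[%classic).
      by apply/funext => s; rewrite indicE mem_setE in_itv/= andbT.
    exact: measurable_indic.
  - by move=> s _; rewrite lee_fin !mulr_ge0.
  rewrite integral_exponential_pdf_shift// /G.
  under [in RHS]eq_integral do rewrite EFinM.
  rewrite /= [in RHS]ge0_integralZl//=; last 2 first.
  - apply/measurable_EFinP; apply: measurable_funM; first exact: measurable_exponential_pdf.
    apply: (@measurableT_comp _ _ _ _ _ _ (fun s => \1_D (X s w) : R)) => //.
    exact: measurable_funD.
  - by move=> s _; rewrite lee_fin !mulr_ge0.
  by rewrite muleCA.
rewrite ge0_integralZl//; last 2 first.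
- rewrite -[X in measurable_fun _ X]/(fubini_F leb G).
  exact: measurable_fun_fubini_tonelli_F.
- by move=> w _; apply: integral_ge0 => s _; exact: G0.
have -> : (\int[Px P x]_w \int[leb]_s G (w, s) =
           \int[Px P x]_w \int[leb]_s H (w, s))%E.
  have := @fubini_tonelli _ _ (Omega R) (measurableTypeR R) R (Px P x) leb G mG G0.
  have := @fubini_tonelli _ _ (Omega R) (measurableTypeR R) R (Px P x) leb H mH H0.
  move=> -> ->.
  apply: eq_integral => s _.
  have [s0|s0] := ltP s 0.
    rewrite !integral0_eq// => w _; rewrite /G /H /= lt0_exponential_pdf//.
      by rewrite mul0e mule0.
    by rewrite mul0r mulr0.
  transitivity ((exponential_pdf q s)%:E *
      Px P x (A `&` X (r + s) @^-1` D))%E.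
    rewrite -[X in Px P x X]setIT -integral_indic//.
    rewrite -ge0_integralZl//; last 2 first.
    - exact/measurable_EFinP/measurable_indic.
    - by rewrite lee_fin.
    apply: eq_integral => w _; rewrite /G /= -EFinM; congr EFin.
    by rewrite indicI /= mulrCA.
  rewrite markov_X// -ge0_integralZl//.
  - by apply: eq_integral => w _; rewrite /H /= muleCA.
  - apply: emeasurable_funM; first exact/measurable_EFinP/measurable_indic.
    apply: (@measurableT_comp _ _ _ _ _ _
      (fun z : Omega R * R => transition D z.2 (X r z.1)) _ (fun w => (w, s))).
      exact: measurable_transition_X.
    exact: measurable_fun_pair.
  - by move=> w _; rewrite mule_ge0// ?lee_fin// transition_ge0.
  - by rewrite lee_fin.
rewrite -ge0_integralZl//; last 2 first.
- rewrite -[X in measurable_fun _ X]/(fubini_F leb H).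
  exact: measurable_fun_fubini_tonelli_F.
- by move=> w _; apply: integral_ge0 => s _; exact: H0.
apply: eq_integral => w _; rewrite /H /=.
rewrite ge0_integralZl//; last 2 first.
- apply: emeasurable_funM.
    by apply/measurable_EFinP; exact: measurable_exponential_pdf.
  apply: (@measurableT_comp _ _ _ _ _ _
    (fun z : Omega R * R => transition D z.2 (X r z.1)) _ (fun s => (w, s))).
    exact: measurable_transition_X.
  exact: measurable_fun_pair.
- by move=> s _; rewrite mule_ge0// ?lee_fin// transition_ge0.
by rewrite muleA -EFinM mulrC.
Qed.

End resolvent.

(** * The strong Markov property *)

Section strong_markov.
Context {R : realType} (P : probability (Omega R) R) (P_levy : levy_process P).
Implicit Types (w : Omega R) (r s t x y : R) (D : set R) (S : Omega R -> \bar R).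
Notation leb := (@lebesgue_measure R).

(** The discount e^(-qT), equal to 0 for an infinite time. *)
Definition discount (q : R) (S : \bar R) : R := if S is r%:E then expR (- q * r) else 0.

Lemma discount_ge0 q T : 0 <= discount q T.
Proof. by case: T => //= r; rewrite expR_ge0. Qed.

Lemma discount_le1 q T : 0 <= q -> (0 <= T)%E -> discount q T <= 1.
Proof.
case: T => //= r q0; rewrite lee_fin => r0.
by rewrite -[leRHS]expR0 ler_expR mulNr oppr_le0 mulr_ge0.
Qed.

Lemma measurable_discount q : measurable_fun setT (discount q).
Proof.
rewrite (_ : discount q = fun T => expR (- q * fine T) * \1_(EFin @` setT) T).
  apply: measurable_funM.
    apply: measurableT_comp => //; apply: measurable_funM => //.

  apply: measurable_indic; rewrite (_ : _ @` _ = ~` [set -oo%E; +oo%E]).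
    by apply: measurableC; apply: measurableU; exact: emeasurable_set1.
  apply/seteqP; split=> [_ [r _ <-] []//|[r _| |]] /=; first by exists r.
    by move=> H; exfalso; apply: H; right.
  by move=> H; exfalso; apply: H; left.
apply/funext => -[r| |] /=; rewrite indicE.
- by rewrite mem_set ?mulr1//; exists r.
- by rewrite memNset ?mulr0// => -[].
- by rewrite memNset ?mulr0// => -[].
Qed.

(** The time spent in D strictly after T, weighted by the exponential density
    of rate q. *)
Definition occupation q D (T : \bar R) w : \bar R :=
  (\int[leb]_s (exponential_pdf q s * ((T < s%:E)%E%:R * \1_D (X s w)))%:E)%E.

Lemma occupation_pinfty q D w : occupation q D +oo w = 0%E.
Proof.
rewrite /occupation integral0_eq// => s _.
by rewrite ltNge leey /= mul0r mulr0.
Qed.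

Lemma occupation_ge0 q D T w : 0 < q -> (0 <= occupation q D T w)%E.
Proof.
move=> q0; apply: integral_ge0 => s _.
by rewrite lee_fin !mulr_ge0// exponential_pdf_ge0// ltW.
Qed.

Lemma measurable_occupation_integrand2 q D S : 0 < q -> measurable D ->
  measurable_fun setT S ->
  measurable_fun setT (fun z : Omega R * R =>
    exponential_pdf q z.2 * ((S z.1 < z.2%:E)%E%:R * \1_D (X z.2 z.1))).
Proof.
move=> q0 mD mS.
apply: measurable_funM.
  apply: (@measurableT_comp _ _ _ _ _ _ (exponential_pdf q)) => //.
  exact: measurable_exponential_pdf.
apply: measurable_funM.
  rewrite (_ : (fun _ => _) = \1_[set z : Omega R * R | (S z.1 < z.2%:E)%E]).
    apply: measurable_indic; rewrite -[X in measurable X]setTI.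
    apply: measurable_lte => //.
      by apply: (@measurableT_comp _ _ _ _ _ _ S).
    by apply/measurable_EFinP; exact: measurable_snd.
  by apply/funext => z; rewrite indicE mem_setE.
by apply: (@measurableT_comp _ _ _ _ _ _ (\1_D : R -> R)) => //; exact: measurable_X2.
Qed.

Lemma measurable_occupation q D S : 0 < q -> measurable D ->
  measurable_fun setT S ->
  measurable_fun setT (fun w => occupation q D (S w) w).
Proof.
move=> q0 mD mS.
pose f (z : Omega R * R) :=
  (exponential_pdf q z.2 * ((S z.1 < z.2%:E)%E%:R * \1_D (X z.2 z.1)))%:E.
rewrite -[X in measurable_fun _ X]/(fubini_F leb f).
apply: measurable_fun_fubini_tonelli_F => //.
  by apply/measurable_EFinP; exact: measurable_occupation_integrand2.
move=> z; by rewrite lee_fin !mulr_ge0// exponential_pdf_ge0// ltW.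
Qed.

Lemma measurable_occupation_integrand q D T w : measurable D -> 0 < q ->
  measurable_fun setT (fun s : R =>
    exponential_pdf q s * ((T < s%:E)%E%:R * \1_D (X s w))).
Proof.
move=> mD q0.
have H := measurable_occupation_integrand2 q0 mD (@measurable_cst _ _ (Omega R) _ setT T).
apply: (@measurableT_comp _ _ _ _ _ _ (fun z : Omega R * R =>
  exponential_pdf q z.2 * ((T < z.2%:E)%E%:R * \1_D (X z.2 z.1))) _
  (fun s : R => (w, s))); first exact: H.
exact: measurable_fun_pair.
Qed.

Lemma occupation_le1 q D T w : 0 < q -> measurable D ->
  (occupation q D T w <= 1)%E.
Proof.
move=> q0 mD; rewrite -(integral_exponential_pdf q0).
have pdf0 s : 0 <= exponential_pdf q s by apply: exponential_pdf_ge0; exact: ltW.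
apply: ge0_le_integral => //.
- by move=> s _; rewrite lee_fin !mulr_ge0.
- by apply/measurable_EFinP; exact: measurable_occupation_integrand.
- by apply/measurable_EFinP; exact: measurable_exponential_pdf.
- move=> s _; rewrite lee_fin ler_piMr// mulr_ile1//.
  by case: (_ < _)%E.
Qed.

(** The exceptional time r is needed for increasing limits: if T_n increases
    strictly to T, the indicators of s > T_n do not converge to that of s > T
    at the single point s = T. *)
Lemma occupation_cvg q D (T_ : (\bar R)^nat) T w r : 0 < q -> measurable D ->
  (forall s, s != r ->
    (T_ n < s%:E)%E%:R @[n --> \oo] --> ((T < s%:E)%E%:R : R)) ->
  (occupation q D (T_ n) w @[n --> \oo] --> occupation q D T w)%E.
Proof.
move=> q0 mD Tcvg.
have pdf0 s : 0 <= exponential_pdf q s by apply: exponential_pdf_ge0; exact: ltW.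
have [||||| _ _ //] := @dominated_convergence _ _ _ leb setT measurableT
  (fun n s => (exponential_pdf q s * ((T_ n < s%:E)%E%:R * \1_D (X s w)))%:E)
  (fun s => (exponential_pdf q s * ((T < s%:E)%E%:R * \1_D (X s w)))%:E)
  (fun s => (exponential_pdf q s)%:E).
- move=> n; apply/measurable_EFinP; exact: measurable_occupation_integrand.
- apply/measurable_EFinP; exact: measurable_occupation_integrand.
- exists [set r]; split => //; first exact: lebesgue_measure_set1.
  move=> s /= sr; apply: contrapT => /eqP nsr; apply: sr => _.
  apply: cvg_EFin; first exact: nearW.
  by apply: cvgM; [exact: cvg_cst|apply: cvgM; [exact: Tcvg|exact: cvg_cst]].
- exact: integrable_exponential_pdf.
- apply: aeW => s n _; rewrite lee_fin ger0_norm ?mulr_ge0//.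
  rewrite ler_piMr// mulr_ile1//.
  by case: (_ < _)%E.
Qed.

Lemma potential_le1 q D y : 0 < q -> measurable D -> (potential P q D y <= 1)%E.
Proof.
move=> q0 mD; rewrite -(integral_exponential_pdf q0).
have pdf0 s : 0 <= exponential_pdf q s by apply: exponential_pdf_ge0; exact: ltW.
apply: ge0_le_integral => //.
- by move=> s _; rewrite mule_ge0// ?lee_fin// transition_ge0.
- apply: emeasurable_funM.
    by apply/measurable_EFinP; exact: measurable_exponential_pdf.
  apply: (@measurableT_comp _ _ _ _ _ _
    (fun z : R * R => transition P D z.2 z.1) _ (fun s => (y, s))).
    exact: measurable_transition2.
  exact: measurable_fun_pair.
- by apply/measurable_EFinP; exact: measurable_exponential_pdf.
- move=> s _; rewrite -[leRHS]mule1 lee_wpmul2l ?lee_fin//.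
  apply: probability_le1; rewrite -[X in measurable X]setTI.
  suff : measurable_fun setT (fun w : Omega R => y + X s w) by apply.
  exact: measurable_funD.
Qed.

Lemma markov_occupation q x r (A : set (cadlag R)) D (V : R -> R) :
  0 < q -> 0 <= r -> F_raw r A -> measurable D ->
  (forall y, (V y)%:E = potential P q D y) ->
  (\int[Px P x]_(w in A) occupation q D r%:E w =
   \int[Px P x]_(w in A) (expR (- q * r) * V (X r w))%:E)%E.
Proof.
move=> q0 r0 rA mD VE.
pose I w : \bar R := (\int[leb]_s (\1_A w *
  (exponential_pdf q s * ((r < s)%R%:R * \1_D (X s w))))%:E)%E.
transitivity (\int[Px P x]_w I w)%E.
  rewrite integral_mkcond; apply: eq_integral => w _; rewrite patchE /I indicE.
  case: ifPn => wA.
    apply: eq_integral => s _; rewrite mul1r.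
    by rewrite lte_fin.
  by rewrite integral0_eq// => s _; rewrite mul0r.
rewrite (markov_resolvent P_levy x q0 r0 rA mD) [RHS]integral_mkcond.
apply: eq_integral => w _; rewrite patchE -VE indicE.
by case: ifPn => wA; rewrite -EFinM ?mul1r// !mul0r.
Qed.

Definition grid_time n (T : \bar R) : \bar R :=
  if T is r%:E then (grid_up n (grid n r))%:E else T.

Lemma measurable_grid_time n : measurable_fun setT (grid_time n).
Proof.
rewrite (_ : grid_time n = fun T : \bar R => if (T \is a fin_num)
    then (grid_up n (grid n (fine T)))%:E else T); last first.
  by apply/funext => -[].
apply: measurable_fun_ifT => //.
- have -> : (fun T : \bar R => T \is a fin_num) =
      fun T => (-oo < T)%E && (T < +oo)%E.
    by apply/funext => T; rewrite fin_numElt.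
  by apply: measurable_and; exact: measurable_fun_lte.
- apply/measurable_EFinP.
  apply: (@measurableT_comp _ _ _ _ _ _ (fun r => grid_up n (grid n r))) => //.
  move=> _ B mB; rewrite setTI.
  rewrite (_ : _ @^-1` B = \bigcup_(k in [set k | B (grid_up n k)])
      (grid n @^-1` [set k])).
    by apply: bigcup_measurable => k _; exact: measurable_grid.
  apply/seteqP; split=> [r Br|r [k /= Bk rk]]; last by rewrite /= rk.
  by exists (grid n r).
Qed.

(** Approximation from strictly above makes the convergence hold at every s,
    including s = T. *)
Lemma grid_time_cvg_lt T s : (0 <= T)%E ->
  (grid_time n T < s%:E)%E%:R @[n --> \oo] --> ((T < s%:E)%E%:R : R).
Proof.
case: T => [r| |] //=; rewrite ?lee_fin => r0; last exact: cvg_cst.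
have [rs|sr] := ltP r s.
  rewrite lte_fin rs; apply: cvg_near_cst.
  have : \forall n \near \oo, grid_up n (grid n r) < s.
    exact: (cvgr_lt _ (grid_up_cvg r0)).
  by apply: filterS => n ns; rewrite lte_fin ns.
rewrite lte_fin ltNge sr; apply: cvg_near_cst; apply: nearW => n.
by rewrite lte_fin ltNge (le_trans sr)// ltW// lt_grid_up.
Qed.

Section at_stopping_time.
Variables (q x : R) (D : set R) (V : R -> R) (S : Omega R -> \bar R).
Variable A : set (cadlag R).
Hypotheses (q0 : 0 < q) (mD : measurable D).
Hypothesis VE : forall y, (V y)%:E = potential P q D y.
Hypothesis V_seq : forall (y_ : R^nat) y, y_ n @[n --> \oo] --> y ->
  V (y_ n) @[n --> \oo] --> V y.
Hypotheses (mS : measurable_fun setT S) (S0 : forall w, (0 <= S w)%E).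
Hypothesis mA : measurable (A : set (Omega R)).
Hypothesis AS : forall r, F_raw r (A `&` [set w | (S w < r%:E)%E]).

Lemma measurable_V : measurable_fun setT V.
Proof.
apply/measurable_EFinP; rewrite (_ : _ \o _ = potential P q D).
  exact: measurable_potential.
exact/funext/VE.
Qed.

Lemma V_ge0 y : 0 <= V y.
Proof.
rewrite -lee_fin VE; apply: integral_ge0 => s _; rewrite mule_ge0//.
by rewrite lee_fin exponential_pdf_ge0// ltW.
Qed.

Lemma V_le1 y : V y <= 1.
Proof. by rewrite -lee_fin VE potential_le1. Qed.

Lemma measurable_X_at (T : Omega R -> \bar R) : measurable_fun setT T ->
  measurable_fun setT (fun w => X (fine (T w)) w).
Proof.
move=> mT; apply: (@measurableT_comp _ _ _ _ _ _
  (fun z : Omega R * R => X z.2 z.1) _ (fun w => (w, fine (T w)))).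
  exact: measurable_X2.
by apply: measurable_fun_pair => //; apply: measurableT_comp.
Qed.

Lemma measurable_discountV (T : Omega R -> \bar R) : measurable_fun setT T ->
  measurable_fun setT (fun w => discount q (T w) * V (X (fine (T w)) w)).
Proof.
move=> mT; apply: measurable_funM.
  by apply: measurableT_comp => //; exact: measurable_discount.
apply: measurableT_comp; first exact: measurable_V.
exact: measurable_X_at.
Qed.

Let piece n k := (A `&` [set w | (S w < (grid_up n k)%:E)%E]) `\`
  (A `&` [set w | (S w < (k%:R / n.+1%:R)%:E)%E]).

Let F_piece n k : F_raw (grid_up n k) (piece n k).
Proof.
apply: F_rawD; first exact: AS.
apply: (@F_raw_le _ (k%:R / n.+1%:R)); last exact: AS.
by rewrite /grid_up ler_pM2r ?invr_gt0// ler_nat.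
Qed.

Let pieceE n k w : piece n k w <->
  A w /\ exists2 r, S w = r%:E & grid n r = k.
Proof.
split.
  move=> [[Aw /=]]; have := S0 w; case: (S w) => [r| |]//; rewrite !lte_fin.
  rewrite lee_fin => r0 rk kr; split => //; exists r => //; apply/eqP.
  by rewrite gridE// rk andbT leNgt; apply/negP => rk'; apply: kr.
move=> [Aw [r Sr /eqP]]; rewrite gridE; last by rewrite -lee_fin -Sr.
move=> /andP[kr rk]; split; first by split => //=; rewrite Sr lte_fin.
by move=> [_ /=]; rewrite Sr lte_fin ltNge kr.
Qed.

Let bigcup_piece n : \bigcup_k piece n k = A `&` [set w | (S w < +oo)%E].
Proof.
apply/seteqP; split=> w.
  by move=> [k _ /pieceE[Aw [r Sr _]]]; split => //=; rewrite Sr ltry.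
move=> [Aw /=]; have := S0 w; case E : (S w) => [r| |]// _ _.
by exists (grid n r) => //; apply/pieceE; split => //; exists r.
Qed.

Let trivIset_piece n : trivIset setT (piece n).
Proof.
apply/trivIsetP => i j _ _; apply: contraNeq => /set0P[w [/pieceE[_ [r Sr ri]]]].
by move=> /pieceE[_ [r' ]]; rewrite Sr => -[<-]; rewrite ri => ->.
Qed.

(** A time that takes its values on a grid is handled one value at a time: on
    each piece the Markov property at a fixed time applies. *)
Lemma strong_markov_grid n :
  (\int[Px P x]_(w in A) occupation q D (grid_time n (S w)) w =
   \int[Px P x]_(w in A) (discount q (grid_time n (S w)) *
     V (X (fine (grid_time n (S w))) w))%:E)%E.
Proof.
have mG : measurable_fun setT (fun w => grid_time n (S w)).
  by apply: measurableT_comp => //; exact: measurable_grid_time.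
have mpiece k : measurable (piece n k : set (Omega R)).
  apply: (@F_raw_measurable _ (grid_up n k)).
  exact: F_piece.
pose E := A `&` [set w | (S w < +oo)%E].
have onE (h : Omega R -> \bar R) : (forall w, S w = +oo%E -> h w = 0%E) ->
    (\int[Px P x]_(w in A) h w = \int[Px P x]_(w in E) h w)%E.
  move=> h0; rewrite integral_mkcond [RHS]integral_mkcond.
  apply: eq_integral => w _; rewrite !patchE /E in_setI.
  case: ifPn => //= wA; case: ifPn => //; rewrite notin_setE /= ltey.
  by move=> /negP; rewrite negbK => /eqP /h0.
rewrite [LHS]onE; last by move=> w ->; exact: occupation_pinfty.
rewrite [RHS]onE; last by move=> w ->; rewrite mul0r.
rewrite /E -(bigcup_piece n) !ge0_integral_bigcup//; last 4 first.
- apply/measurable_EFinP; apply: measurable_funTS; exact: measurable_discountV.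
- by move=> w _; rewrite lee_fin mulr_ge0 ?discount_ge0 ?V_ge0.
- by apply: measurable_funTS; exact: measurable_occupation.
- by move=> w _; exact: occupation_ge0.
apply: eq_eseriesr => k _.
transitivity (\int[Px P x]_(w in piece n k) occupation q D (grid_up n k)%:E w)%E.
  by apply: eq_integral => w /set_mem /pieceE[_ [r -> <-]].
rewrite (markov_occupation _ q0 _ (@F_piece n k) mD VE); last first.
  exact/ltW/grid_up_gt0.
by apply: eq_integral => w /set_mem /pieceE[_ [r -> <-]].
Qed.

(** The hypothesis on S is about the events S < r, not S <= r; accordingly the
    event A only has to belong to the right-continuous past of S.  Sequential
    continuity of V is what passes to the limit along the grid, since paths are
    right-continuous. *)
Lemma strong_markov :
  (\int[Px P x]_(w in A) occupation q D (S w) w =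
   \int[Px P x]_(w in A) (discount q (S w) * V (X (fine (S w)) w))%:E)%E.
Proof.
have mG n : measurable_fun setT (fun w => grid_time n (S w)).
  by apply: measurableT_comp => //; exact: measurable_grid_time.
have grid_ge0 n w : (0 <= grid_time n (S w))%E.
  have := S0 w; case: (S w) => //= r _.
  by rewrite lee_fin; exact/ltW/grid_up_gt0.
have occ_cvg : (\int[Px P x]_(w in A) occupation q D (grid_time n (S w)) w
    @[n --> \oo] --> \int[Px P x]_(w in A) occupation q D (S w) w)%E.
  apply: (@dominated_cvg _ _ _ (Px P x) A mA _ _ (fun=> 1%E)).
  - by move=> n; apply: measurable_funTS; exact: measurable_occupation.
  - by move=> w _; apply: (@occupation_cvg _ _ _ _ _ 0) => // s _; exact: grid_time_cvg_lt.
  - by [].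
  - exact: (finite_measure_integrable_cst (Px P x) 1 mA).
  - by move=> n w _; rewrite gee0_abs ?occupation_ge0// occupation_le1.
rewrite -(cvg_lim _ occ_cvg)//; apply/cvg_lim => //.
under eq_fun do rewrite strong_markov_grid.
apply: (@bounded_cvg _ _ _ (Px P x) A _ _ 1) => //.
- by move=> n; apply: measurable_funTS; exact: measurable_discountV.
- move=> w _; have := S0 w; case: (S w) => [r| |] //=; rewrite ?lee_fin => r0.
    have rcvg := grid_up_cvg r0.
    apply: cvgM.
      by apply: continuous_cvg; [exact: continuous_expR|exact: cvgMr].
    by apply: V_seq; apply: X_seq_right => // n; exact: lt_grid_up.
  exact: cvg_cst.
- move=> n w _; rewrite ger0_norm ?mulr_ge0 ?discount_ge0 ?V_ge0//.
  by rewrite mulr_ile1 ?discount_ge0 ?V_ge0 ?V_le1// discount_le1// ltW.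
Qed.

End at_stopping_time.

End strong_markov.

(** * The resolvent of a small interval *)

Section continuous_bounds.
Context {R : realType}.

Lemma continuous_bounded_on (v : R -> R) (K : R) : continuous v ->
  exists M, 0 <= M /\ forall z, `|z| <= K -> `|v z| <= M.
Proof.
move=> cv; have [K0|K0] := ltP K 0.
  by exists 0; split => // z /le_lt_trans /(_ K0); rewrite ltNge normr_ge0.
have : bounded_set (v @` `[- K, K]).
  apply: compact_bounded; apply: continuous_compact.
    exact: continuous_subspaceT.
  exact: segment_compact.
move=> [M [_ Mb]]; exists (`|M| + 1); split; first by rewrite addr_ge0.
move=> z zK; apply: (Mb (`|M| + 1)).
  by rewrite (le_lt_trans (ler_norm M))// ltrDl.
by exists z => //=; rewrite in_itv/= -ler_norml.
Qed.

End continuous_bounds.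

Section potential_density.
Context {R : realType} (P : probability (Omega R) R) (P_levy : levy_process P).
Implicit Types (w : Omega R) (r s t x y : R) (D : set R).
Notation leb := (@lebesgue_measure R).
Variables (q : R) (v : R -> R).
Hypotheses (q0 : 0 < q) (v_cont : continuous v).
Hypothesis v_dens : forall (f : R -> R) (x : R), measurable_fun setT f ->
  bounded_fun f ->
  (\int[Px P x]_w \int[leb]_(t in `[0%R, +oo[)
     (expR (- q * t) * at_coord f t w)%:E
   = \int[leb]_y (v (y - x) * f y)%:E)%E.

Lemma potential_ge0 D y : (0 <= potential P q D y)%E.
Proof.
apply: integral_ge0 => s _; rewrite mule_ge0//.
by rewrite lee_fin exponential_pdf_ge0// ltW.
Qed.

Lemma potential_fin_num D y : measurable D -> potential P q D y \is a fin_num.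
Proof.
move=> mD; rewrite ge0_fin_numE ?potential_ge0//.
by rewrite (le_lt_trans (potential_le1 P _ q0 mD))// ltry.
Qed.

(** The Markov property at time 0 relates the definition of [potential], which
    uses P and a translated process, to the law P_y. *)
Lemma potentialE D y : measurable D ->
  (potential P q D y = \int[Px P y]_w occupation q D 0%:E w)%E.
Proof.
move=> mD.
have fin z : (fine (potential P q D z))%:E = potential P q D z.
  by rewrite fineK// potential_fin_num.
have -> := markov_occupation P_levy y q0 (lexx 0) (@F_rawT R 0) mD fin.
rewrite -fin -[LHS]mule1 -(@probability_setT _ _ _ (Px P y)) -integral_cst//.
apply: ge0_ae_eq_integral => //.
- apply/measurable_EFinP; apply: measurable_funM => //.
  apply: (@measurableT_comp _ _ _ _ _ _ (fine \o potential P q D)) => //.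
  by apply: measurableT_comp => //; exact: measurable_potential.
- by move=> w _; rewrite lee_fin fine_ge0// potential_ge0.
- by move=> w _; rewrite lee_fin mulr_ge0// ?expR_ge0// fine_ge0// potential_ge0.
- apply: filterS (ae_start P_levy y) => w Xy _.
  by rewrite Xy mulr0 expR0 mul1r.
Qed.

(** The exponential density is q e^(-qs) on the half line, so the two integrands
    differ only at s = 0. *)
Lemma occupation0E D w : measurable D -> ~ dead w ->
  (occupation q D 0%:E w = q%:E * \int[leb]_(t in `[0%R, +oo[)
     (expR (- q * t) * at_coord (\1_D) t w)%:E)%E.
Proof.
move=> mD nd.
have pdf0 s : 0 <= exponential_pdf q s by apply: exponential_pdf_ge0; exact: ltW.
have mexp : measurable_fun setT (fun t : R => expR (- q * t)).
  by apply: measurableT_comp => //; apply: measurable_funM.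
have mf : measurable_fun (`[0%R, +oo[%classic : set R)
    (fun t => expR (- q * t) * at_coord \1_D t w).
  apply: (@eq_measurable_fun _ _ _ _ _ (fun t => expR (- q * t) * \1_D (X t w))).
    move=> t; rewrite inE /= in_itv /= andbT => t0.
    by rewrite /at_coord alive_X.
  apply: measurable_funTS; apply: measurable_funM => //.
  exact: measurable_indic_X.
rewrite -ge0_integralZl//; last 3 first.
- exact/measurable_EFinP.
- move=> t; rewrite /= in_itv /= andbT => t0.
  by rewrite /at_coord alive_X// lee_fin mulr_ge0// expR_ge0.
- by rewrite lee_fin ltW.
rewrite [RHS]integral_mkcond.
apply: (@ge0_integral_eq_off _ 0).
- by apply/measurable_EFinP; exact: measurable_occupation_integrand.
- apply/(measurable_restrictT _ _).1 => //.
  by apply: emeasurable_funM => //; exact/measurable_EFinP.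
- by move=> s; rewrite lee_fin !mulr_ge0.
- move=> s; apply: erestrict_ge0 => t; rewrite /= in_itv /= andbT => t0.
  by rewrite /at_coord alive_X// -EFinM lee_fin !mulr_ge0 ?expR_ge0// ltW.
- move=> s s0; rewrite patchE mem_setE in_itv /= andbT lte_fin.
  case: ifPn => s0'; last first.
    by rewrite lt0_exponential_pdf ?mul0r// ltNge.
  rewrite exponential_pdfE// /at_coord alive_X// -EFinM; congr EFin.
  by rewrite lt_neqAle eq_sym s0 s0' mul1r mulrA.
Qed.

(** The integral that defines u_q involves killed paths; it is evaluated outside
    the null set [dead], and measurability in the path follows by writing the
    indicator of D at a coordinate as a product of two jointly measurable
    functions. *)
Lemma potential_dens D y : measurable D ->
  (potential P q D y = q%:E * \int[leb]_z (v (z - y) * \1_D z)%:E)%E.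
Proof.
move=> mD.
have mI : measurable_fun setT (\1_D : R -> R) by exact: measurable_indic.
have bI : bounded_fun (\1_D : R -> R).
  exists 1; split => // M M1 z _ /=; rewrite indicE ger0_norm//.
  by rewrite (le_trans _ (ltW M1))//; case: (_ \in _).
rewrite -v_dens// potentialE//.
pose J (w : Omega R) := (\int[leb]_(t in `[0%R, +oo[)
     (expR (- q * t) * at_coord \1_D t w)%:E)%E.
have J0 w : (0 <= J w)%E.
  apply: integral_ge0 => t _; rewrite lee_fin mulr_ge0 ?expR_ge0//.
  by rewrite /at_coord; case: (Defs.coord w t).
(* the factor [at_coord (fun=> 1)] is the indicator that the path is alive *)
pose g (z : Omega R * R) : \bar R := ((fun t => expR (- q * t)) \_ `[0%R, +oo[ z.2 *
  (\1_D (X z.2 z.1) * at_coord (fun=> 1) z.2 z.1))%:E.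
have JE w : J w = fubini_F leb g w.
  rewrite /J integral_mkcond; apply: eq_integral => t _; rewrite !patchE /g /=.
  rewrite patchE; case: ifPn => _; last by rewrite mul0r.
  rewrite /X /at_coord; case: (Defs.coord w t) => [z|] /=; first by rewrite mulr1.
  by rewrite !mulr0.
have mJ : measurable_fun setT J.
  rewrite (_ : J = fubini_F leb g); last exact/funext/JE.
  apply: measurable_fun_fubini_tonelli_F.
    apply/measurable_EFinP; apply: measurable_funM.
      apply: (@measurableT_comp _ _ _ _ _ _
        ((fun t => expR (- q * t)) \_ `[0%R, +oo[)) => //.
      apply/(measurable_restrictT _ _).1 => //; apply: measurable_funTS.
      by apply: measurableT_comp => //; apply: measurable_funM.
    apply: measurable_funM.
      apply: (@measurableT_comp _ _ _ _ _ _ (\1_D : R -> R)) => //.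
      exact: measurable_X2.
    by apply: measurable_at_coord2 => z; exact: cst_continuous.
  move=> z; rewrite lee_fin; apply: mulr_ge0.
    by apply: restrict_ge0 => t _; exact: expR_ge0.
  by rewrite mulr_ge0//; rewrite /at_coord; case: (Defs.coord z.1 z.2).
rewrite -ge0_integralZl//; last 2 first.
- by move=> w _; exact: J0.
- by rewrite lee_fin ltW.
apply: ge0_ae_eq_integral => //.
- by apply: measurable_occupation.
- by apply: emeasurable_funM.
- by move=> w _; exact: occupation_ge0.
- by move=> w _; rewrite mule_ge0 ?J0// lee_fin ltW.
- by apply: filterS (ae_alive P_levy y) => w nd _; exact: occupation0E.
Qed.

Definition ball0 n : set R := [set z | `|z| < n.+1%:R^-1].

Lemma ball0E n : ball0 n = `](- n.+1%:R^-1), n.+1%:R^-1[%classic.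
Proof. by apply/seteqP; split=> z; rewrite /ball0 /= in_itv/= ltr_norml. Qed.

Lemma measurable_ball0 n : measurable (ball0 n).
Proof. by rewrite ball0E. Qed.

Lemma lebesgue_ball0 n : leb (ball0 n) = (2 * n.+1%:R^-1)%:E.
Proof.
rewrite ball0E lebesgue_measure_itv/= lte_fin gtrN// ?invr_gt0//.
by rewrite -EFinB opprK mulr_natl mulr2n.
Qed.

(** The potential of [ball0 n] for a density that would be constantly 1. *)
Definition ball0_weight n : R := q * (2 * n.+1%:R^-1).

Lemma ball0_weight_gt0 n : 0 < ball0_weight n.
Proof. by rewrite !mulr_gt0// invr_gt0. Qed.

Definition ball0_potential n y : R := fine (potential P q (ball0 n) y).

Lemma ball0_potentialE n y : (ball0_potential n y)%:E = potential P q (ball0 n) y.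
Proof. by rewrite /ball0_potential fineK// potential_fin_num//; exact: measurable_ball0. Qed.

Lemma ball0_potential_ge0 n y : 0 <= ball0_potential n y.
Proof. by rewrite fine_ge0// potential_ge0. Qed.

Lemma measurable_ball0_potential n : measurable_fun setT (ball0_potential n).
Proof.
apply: measurableT_comp => //.
by apply: measurable_potential => //; exact: measurable_ball0.
Qed.

Lemma v_shift_cont y : continuous (fun z => v (z - y)).
Proof.
move=> z; apply: continuous_comp; last exact: v_cont.
by apply: cvgB; [exact: cvg_id|exact: cvg_cst].
Qed.

Lemma integrable_cst_ball0 n c : leb.-integrable (ball0 n) (EFin \o cst c).
Proof.
apply: (@integrableS _ _ _ leb `[(- n.+1%:R^-1), n.+1%:R^-1]%classic) => //.
- exact: measurable_ball0.
- by rewrite ball0E; apply: subset_itv; rewrite bnd_simp.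
- apply: continuous_compact_integrable; first exact: segment_compact.
  by apply: continuous_subspaceT => z; exact: cst_continuous.
Qed.

Lemma integrable_v_shift n y :
  leb.-integrable (ball0 n) (fun z => (v (z - y))%:E).
Proof.
apply: (@integrableS _ _ _ leb `[(- n.+1%:R^-1), n.+1%:R^-1]%classic) => //.
- exact: measurable_ball0.
- by rewrite ball0E; apply: subset_itv; rewrite bnd_simp.
- apply: continuous_compact_integrable; first exact: segment_compact.
  by apply: continuous_subspaceT; exact: v_shift_cont.
Qed.

Lemma ball0_potential_dens n y :
  ((ball0_potential n y)%:E = q%:E * \int[leb]_(z in ball0 n) (v (z - y))%:E)%E.
Proof.
rewrite ball0_potentialE potential_dens; last exact: measurable_ball0.
congr (_ * _)%E; rewrite [RHS]integral_mkcond; apply: eq_integral => z _.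
rewrite patchE indicE; case: ifPn => _; first by rewrite mulr1.
by rewrite mulr0.
Qed.

Lemma ball0_potential_Rint n y :
  ball0_potential n y = q * \int[leb]_(z in ball0 n) v (z - y).
Proof.
apply: EFin_inj; rewrite ball0_potential_dens EFinM /Rintegral fineK//.
apply: integrable_fin_num; first exact: measurable_ball0.
exact: integrable_v_shift.
Qed.

Lemma ball0_potential_bounds n y lo hi :
  (forall z, `|z| < n.+1%:R^-1 -> lo <= v (z - y) <= hi) ->
  ball0_weight n * lo <= ball0_potential n y <= ball0_weight n * hi.
Proof.
move=> vb; rewrite ball0_potential_Rint /ball0_weight -!mulrA !ler_pM2l//.
have cstE c : \int[leb]_(z in ball0 n) c = 2 * (n.+1%:R^-1 * c).
  rewrite Rintegral_cst; last exact: measurable_ball0.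
  by rewrite [X in fine X](lebesgue_ball0 n) /= mulrC mulrA.
by rewrite -!cstE !le_Rintegral//; try exact: measurable_ball0;
  try exact: integrable_v_shift; try exact: integrable_cst_ball0;
  move=> z zn; have /andP[] := vb _ zn.
Qed.

(** The normalised potential is an average of v over an interval of length
    2/(n+1) around -y_n, and v is continuous. *)
Lemma ball0_potential_cvg (y_ : R^nat) y : y_ n @[n --> \oo] --> y ->
  ball0_potential n (y_ n) / ball0_weight n @[n --> \oo] --> v (- y).
Proof.
move=> yy; apply/cvgrPdist_le => e e0.
have /cvgrPdist_le/(_ _ e0) := v_cont (x := - y).
move=> [d /= d0 vd]; have d20 : 0 < d / 2 by rewrite divr_gt0.
have /cvgrPdist_lt/(_ _ d20) := yy.
have /cvgrPdist_lt/(_ _ d20) := @cvg_harmonic R.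
apply: filterS2 => n; rewrite sub0r normrN /= => nd yd.
have /(ball0_potential_bounds (n := n)) :
    forall z, `|z| < n.+1%:R^-1 -> v (- y) - e <= v (z - y_ n) <= v (- y) + e.
  move=> z zn; rewrite -ler_distlC; apply: vd => /=.
  rewrite (_ : - y - _ = - (z + (y - y_ n))); last by ring.
  rewrite normrN (le_lt_trans (ler_normD _ _))// (splitr d) ltrD//.
  by apply: (lt_trans zn); rewrite -[ltLHS]ger0_norm.
rewrite ler_distlC => /andP[lo hi].
by rewrite ler_pdivlMr ?ler_pdivrMr ?ball0_weight_gt0// mulrC lo mulrC.
Qed.

Lemma ball0_potential_seq n (y_ : R^nat) y : y_ k @[k --> \oo] --> y ->
  ball0_potential n (y_ k) @[k --> \oo] --> ball0_potential n y.
Proof.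
move=> yy.
have [K [K0 Ky]] : exists K, 0 <= K /\ forall k, `|y_ k| <= K.
  have [M [_ My]] := cvg_seq_bounded (cvgP _ yy).
  exists (`|M| + 1); split; first by rewrite addr_ge0.
  move=> k; apply: (My (`|M| + 1)) => //.
  by rewrite (le_lt_trans (ler_norm M))// ltrDl.
have [M [M0 Mv]] := continuous_bounded_on (K + 1) v_cont.
rewrite ball0_potential_Rint; under eq_fun do rewrite ball0_potential_Rint.
apply: cvgMr; rewrite /Rintegral; apply: fine_cvg.
rewrite fineK; last first.
  apply: integrable_fin_num; first exact: measurable_ball0.
  exact: integrable_v_shift.
apply: (@dominated_cvg _ _ _ leb (ball0 n) (measurable_ball0 n) _ _
  (fun=> M%:E)).
- by move=> k; exact: (measurable_int leb (integrable_v_shift n (y_ k))).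
- move=> z _; apply: cvg_EFin; first exact: nearW.
  apply: continuous_cvg; first exact: v_cont.
  by apply: cvgB => //; exact: cvg_cst.
- by [].
- exact: integrable_cst_ball0.
- move=> k z zn; rewrite lee_fin Mv// (le_trans (ler_normB _ _))//.
  rewrite addrC lerD//; apply: ltW; apply: (lt_le_trans zn).
  by rewrite invf_le1// ler1n.
Qed.

End potential_density.

(** * Hitting times of shrinking intervals *)

Section hitting.
Context {R : realType}.
Implicit Types (w : Omega R) (r s t : R) (n : nat).

Lemma X_right_near w s (Q : set R) : (\forall y \near X s w, Q y) ->
  exists d, 0 < d /\ forall s', s < s' -> s' < s + d -> Q (X s' w).
Proof.
move=> /right_continuous_X[d /= d0 dQ]; exists d; split => // s' ss' s'd.
by apply: dQ => //=; rewrite ltr0_norm ?subr_lt0// opprB ltrBlDl.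
Qed.

Definition hit t n w : \bar R :=
  ereal_inf (EFin @` [set s | t <= s /\ `|X s w| < n.+1%:R^-1]).

(** The hitting time of 0 in disguise: [X_hit_limit] shows that the path is at 0
    at this time, almost surely.  Unlike the first zero, it is visibly a
    stopping time. *)
Definition hit_limit t w : \bar R := ereal_sup (range (fun n => hit t n w)).

Lemma hit_ge t n w : (t%:E <= hit t n w)%E.
Proof. by apply: le_ereal_inf_tmp => _ [s [ts _] <-]; rewrite lee_fin. Qed.

Lemma hit_le t n w s : t <= s -> `|X s w| < n.+1%:R^-1 -> (hit t n w <= s%:E)%E.
Proof. by move=> ts Xs; apply: ereal_inf_lbound; exists s. Qed.

Lemma hit_nondecreasing t w : nondecreasing_seq (fun n => hit t n w).
Proof.
move=> m n mn; apply: le_ereal_inf_tmp => _ [s [ts Xs] <-]; apply: hit_le => //.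
by rewrite (lt_le_trans Xs)// lef_pV2 ?posrE// ler_nat.
Qed.

Lemma hit_le_limit t n w : (hit t n w <= hit_limit t w)%E.
Proof. by apply: ereal_sup_ubound; exists n. Qed.

Lemma hit_limit_ge t w : (t%:E <= hit_limit t w)%E.
Proof. exact: le_trans (hit_ge t 0 w) (hit_le_limit t 0 w). Qed.

(** The inequality is not strict because the infimum may be reached only as a
    limit from the right. *)
Lemma norm_X_hit t n w r : hit t n w = r%:E -> `|X r w| <= n.+1%:R^-1.
Proof.
move=> hr; rewrite leNgt; apply/negP => nX.
have /X_right_near[d [d0 dX]] : \forall y \near X r w, n.+1%:R^-1 < `|y|.
  have /cvgr_gt : `|y| @[y --> X r w] --> `|X r w| by exact: norm_continuous.
  exact.
have : (hit t n w < (r + d)%:E)%E by rewrite hr lte_fin ltrDl.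
move=> /ereal_inf_lt[_ [s [ts Xs] <-]]; rewrite lte_fin => sd.
have rs : r <= s by rewrite -lee_fin -hr hit_le.
move: Xs; rewrite ltNge => /negP; apply; apply: ltW.
by move: rs; rewrite le_eqVlt => /predU1P[<-//|rs]; exact: dX.
Qed.

(** A visit to an open interval lasts for some time, by right-continuity, hence
    it is seen at a rational time. *)
Lemma hit_lt_rat t n w r : (hit t n w < r%:E)%E <->
  exists p : rat, t <= ratr p /\ ratr p < r /\ `|X (ratr p) w| < n.+1%:R^-1.
Proof.
split=> [/ereal_inf_lt[_ [s [ts Xs] <-]]|[p [tp [pr Xp]]]]; last first.
  by rewrite (le_lt_trans (hit_le tp Xp))// lte_fin.
rewrite lte_fin => sr.
have /X_right_near[d [d0 dX]] : \forall y \near X s w, `|y| < n.+1%:R^-1.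
  have /cvgr_lt : `|y| @[y --> X s w] --> `|X s w| by exact: norm_continuous.
  exact.
have : s < Num.min r (s + d) by rewrite lt_min sr ltrDl.
move=> /rat_in_itvoo[p]; rewrite in_itv/= lt_min => /andP[sp /andP[pr pd]].
by exists p; split; [exact: (le_trans ts (ltW sp))|split => //; exact: dX].
Qed.

Lemma F_raw_hit t n (A : set (cadlag R)) r : 0 <= t -> F_rawplus t A ->
  F_raw r (A `&` [set w | (hit t n w < r%:E)%E]).
Proof.
move=> t0 tA; have [rt|tr] := leP r t.
  rewrite (_ : _ `&` _ = set0); first exact: F_raw0.
  apply/seteqP; split=> // w [_ /=]; apply/negP; rewrite -leNgt.
  by rewrite (le_trans _ (hit_ge t n w))// lee_fin.
apply: F_rawI; first exact: tA.
pose F (p : rat) : set (cadlag R) := if (t <= ratr p) && (ratr p < r)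
  then X (ratr p) @^-1` (ball0 n) else set0.
rewrite (_ : [set _ | _] = \bigcup_p F p).
  apply: (@bigcupT_measurable_rat _ (past r)) => p; rewrite /F.
  case: ifPn => [/andP[tp pr]|_]; last exact: measurable0.
  apply: F_raw_X; [exact: le_trans tp|exact: ltW|exact: measurable_ball0].
apply/seteqP; split=> w /=.
  by move=> /hit_lt_rat[p [tp [pr Xp]]]; exists p => //; rewrite /F tp pr.
move=> [p _]; rewrite /F; case: ifPn => // /andP[tp pr] Xp.
by apply/hit_lt_rat; exists p.
Qed.

(** A supremum is smaller than r if and only if all terms are smaller than
    r - 1/(m+1) for a common m: countably many strict inequalities replace the
    supremum. *)
Lemma lt_bound_seqP (S : (\bar R)^nat) r :
  (exists2 c : R, c < r & forall n, (S n <= c%:E)%E) <->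
  exists m : nat, forall n, (S n < (r - m.+1%:R^-1)%:E)%E.
Proof.
split=> [[c cr Sc]|[m Sm]]; last first.
  exists (r - m.+1%:R^-1); first by rewrite ltrBlDr ltrDl invr_gt0.
  by move=> n; exact/ltW/Sm.
have rc : 0 < r - c by rewrite subr_gt0.
(* the index is such that 1/(m+1) < r - c *)
exists (Num.truncn (r - c)^-1) => n; rewrite (le_lt_trans (Sc n))// lte_fin.
by rewrite ltrBrDr -ltrBrDl invf_plt ?posrE// truncnS_gt.
Qed.

Lemma F_raw_hit_limit t (A : set (cadlag R)) r : 0 <= t -> F_rawplus t A ->
  F_raw r (A `&` [set w | (hit_limit t w < r%:E)%E]).
Proof.
move=> t0 tA.
rewrite (_ : _ `&` _ = \bigcup_m \bigcap_n
    (A `&` [set w | (hit t n w < (r - m.+1%:R^-1)%:E)%E])).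
  apply: F_raw_bigcup => m; apply: F_raw_bigcap => n.
  apply: (@F_raw_le _ (r - m.+1%:R^-1)); first by rewrite lerBlDr lerDl invr_ge0.
  exact: F_raw_hit.
apply/seteqP; split=> w.
  move=> [Aw /= hr].
  have [m Hm] : exists m : nat, forall n, (hit t n w < (r - m.+1%:R^-1)%:E)%E.
    apply/lt_bound_seqP; exists (fine (hit_limit t w)).
      move: hr; have := hit_limit_ge t w.
      by case: (hit_limit t w) => [c| |] //=; rewrite lte_fin.
    move=> n; rewrite (le_trans (hit_le_limit t n w))//.
    move: hr; have := hit_limit_ge t w.
    by case: (hit_limit t w) => [c| |].
  by exists m => // n _; split => //=.
move=> [m _ Hm]; split; first by have [] := Hm 0 I.
have /lt_bound_seqP[c cr hc] : exists m : nat, forall n,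
    (hit t n w < (r - m.+1%:R^-1)%:E)%E.
  by exists m => n; have [] := Hm n I.
rewrite /= (@le_lt_trans _ _ c%:E) ?lte_fin//.
by apply: ge_ereal_sup => _ [n _ <-].
Qed.

Lemma measurable_of_lt d (T : measurableType d) (S : T -> \bar R) :
  (forall r, measurable [set z | (S z < r%:E)%E]) -> measurable_fun setT S.
Proof.
move=> mS; apply: (measurability _ (ErealGenCInfty.measurableE R)) => //.
move=> _ [_ [r ->] <-]; rewrite setTI.
rewrite (_ : _ @^-1` _ = ~` [set z | (S z < r%:E)%E]); first exact: measurableC.
apply/seteqP; split=> z /=; rewrite in_itv/= andbT leNgt; first by move/negP.
by move=> H; exact/negP.
Qed.

Lemma F_rawplusT t : F_rawplus t [set: cadlag R].
Proof. by move=> s _; exact: F_rawT. Qed.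

Lemma F_rawplusI t (A B : set (cadlag R)) :
  F_rawplus t A -> F_rawplus t B -> F_rawplus t (A `&` B).
Proof. by move=> tA tB s ts; apply: F_rawI; [exact: tA|exact: tB]. Qed.

Lemma F_rawplusC t (A : set (cadlag R)) : F_rawplus t A -> F_rawplus t (~` A).
Proof. by move=> tA s ts; apply: F_rawC; exact: tA. Qed.

Lemma F_rawplus_measurable t (A : set (Omega R)) : F_rawplus t A -> measurable A.
Proof.
move=> tA; apply: (@F_raw_measurable _ (t + 1)); apply: tA => /=.
by rewrite ltrDl.
Qed.

Lemma measurable_hit t n : 0 <= t -> measurable_fun setT (hit t n).
Proof.
move=> t0; apply: measurable_of_lt => r; rewrite -[X in measurable X]setTI.
apply: (@F_raw_measurable _ r); apply: F_raw_hit => //; exact: F_rawplusT.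
Qed.

Lemma measurable_hit_limit t : 0 <= t -> measurable_fun setT (hit_limit t).
Proof.
move=> t0; apply: measurable_of_lt => r; rewrite -[X in measurable X]setTI.
apply: (@F_raw_measurable _ r); apply: F_raw_hit_limit => //; exact: F_rawplusT.
Qed.

(** Events T <= t are intersections of events T < t + s with s arbitrarily small,
    so they belong to the right limit of the filtration at t only. *)
Lemma F_rawplus_lt_hit_limit t : 0 <= t ->
  F_rawplus t [set w | (t%:E < hit_limit 0 w)%E].
Proof.
move=> t0 s /= ts; rewrite (_ : [set _ | _] = ~` \bigcap_k
    [set w | (hit_limit 0 w < (t + (s - t) / k.+1%:R)%:E)%E]).
  apply: F_rawC; apply: F_raw_bigcap => k.
  apply: (@F_raw_le _ (t + (s - t) / k.+1%:R)).
    rewrite -lerBrDl ler_pdivrMr// ler_peMr ?ler1n// subr_ge0 ltW//.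
  by rewrite -[X in F_raw _ X]setTI; apply: F_raw_hit_limit => //; exact: F_rawplusT.
apply/seteqP; split=> w /=.
  move=> th H; move: th; apply/negP; rewrite -leNgt.
  apply/lee_addgt0Pr => e e0.
  have := H (Num.truncn ((s - t) / e)) I => /= /ltW /le_trans; apply.
  rewrite -EFinD lee_fin lerD2l ler_pdivrMr// mulrC -ler_pdivrMr//.
  exact/ltW/truncnS_gt.
move=> H; rewrite ltNge; apply/negP => ht; apply: H => k _ /=.
by rewrite (le_lt_trans ht)// lte_fin ltrDl divr_gt0// subr_gt0.
Qed.

(** Between t and the hitting time nothing is spent in the interval; the hitting
    time itself is a single point, of Lebesgue measure 0. *)
Lemma occupation_hit q t n w : 0 < q ->
  occupation q (ball0 n) t%:E w = occupation q (ball0 n) (hit t n w) w.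
Proof.
move=> q0.
have pdf0 s : 0 <= exponential_pdf q s by apply: exponential_pdf_ge0; exact: ltW.
apply: (@ge0_integral_eq_off _ (fine (hit t n w))).
- apply/measurable_EFinP; apply: measurable_occupation_integrand => //.
  exact: measurable_ball0.
- apply/measurable_EFinP; apply: measurable_occupation_integrand => //.
  exact: measurable_ball0.
- by move=> s; rewrite lee_fin !mulr_ge0.
- by move=> s; rewrite lee_fin !mulr_ge0.
move=> s sh; congr EFin; congr (_ * _).
rewrite indicE; have [/set_mem sm|_] := boolP (X s w \in ball0 n); last first.
  by rewrite !mulr0.
suff -> : (t%:E < s%:E)%E = (hit t n w < s%:E)%E by [].
apply/idP/idP => [|hs]; rewrite lte_fin.
  move=> ts; rewrite lt_neqAle hit_le ?(ltW ts)// andbT.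
  by apply: contra sh => /eqP ->.
by rewrite -lte_fin (le_lt_trans (hit_ge t n w)).
Qed.

Lemma discount_cvg q (T_ : (\bar R)^nat) T : 0 < q -> (forall n, 0 <= T_ n)%E ->
  nondecreasing_seq T_ -> T = ereal_sup (range T_) ->
  discount q (T_ n) @[n --> \oo] --> discount q T.
Proof.
move=> q0 T0 ndT ET.
have Tcvg : T_ n @[n --> \oo] --> T.
  by rewrite ET; exact: ereal_nondecreasing_cvgn.
have TT n : (T_ n <= T)%E by rewrite ET; apply: ereal_sup_ubound; exists n.
case: T {ET} Tcvg TT => [r| |] Tcvg TT.
- have Tfin n : T_ n \is a fin_num.
    by rewrite ge0_fin_numE// (le_lt_trans (TT n))// ltry.
  rewrite (_ : (fun n => _) = fun n => expR (- q * fine (T_ n))); last first.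
    by apply/funext => n; rewrite -{1}(fineK (Tfin n)).
  apply: continuous_cvg; first exact: continuous_expR.
  by apply: cvgMr; exact: (fine_cvg Tcvg).
- apply/cvgrPdist_le => e e0.
  (* beyond r = 1/(e q) the discount is at most 1/(1 + q r) < e *)
  have /cvgeyPge/(_ (e^-1 / q)) := Tcvg.
  apply: filterS => n Tn; rewrite sub0r normrN ger0_norm ?discount_ge0//.
  case: (T_ n) Tn => [r| |] //=; last by move=> _; exact: ltW.
  rewrite lee_fin ler_pdivrMr// => er.
  rewrite mulNr expRN -[leRHS]invrK lef_pV2 ?posrE ?expR_gt0 ?invr_gt0//.
  rewrite (le_trans er)// mulrC (le_trans _ (expR_ge1Dx _))//.
  by rewrite lerDr.
- by have := le_trans (T0 0) (TT 0).
Qed.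

Lemma discount_hit_cvg q t w : 0 < q -> 0 <= t ->
  discount q (hit t n w) @[n --> \oo] --> discount q (hit_limit t w).
Proof.
move=> q0 t0; apply: discount_cvg => //; last exact: hit_nondecreasing.
by move=> n; rewrite (le_trans _ (hit_ge t n w))// lee_fin.
Qed.

Lemma X_hit_cvg t w r : hit_limit t w = r%:E ->
  X (fine (hit t n w)) w @[n --> \oo] --> (0 : R).
Proof.
move=> hr; apply/norm_cvg0P.
apply: (@squeeze_cvgr _ _ _ _ (fun=> 0) (fun n => n.+1%:R^-1)).
- apply: nearW => n; rewrite normr_ge0 /=; apply: norm_X_hit.
  rewrite fineK// fin_numElt (lt_le_trans _ (hit_ge t n w)) ?ltNyr//=.
  by rewrite (le_lt_trans (hit_le_limit t n w))// hr ltry.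
- exact: cvg_cst.
- exact: (@cvg_harmonic R).
Qed.

End hitting.

(** * The hitting time of zero *)

Section hitting_law.
Context {R : realType} (P : probability (Omega R) R) (P_levy : levy_process P).
Implicit Types (w : Omega R) (r s t x y : R) (A : set (cadlag R)).
Notation leb := (@lebesgue_measure R).
Variables (q : R) (v : R -> R).
Hypotheses (q0 : 0 < q) (v_cont : continuous v).
Hypothesis v_dens : forall (f : R -> R) (x : R), measurable_fun setT f ->
  bounded_fun f ->
  (\int[Px P x]_w \int[leb]_(t in `[0%R, +oo[)
     (expR (- q * t) * at_coord f t w)%:E
   = \int[leb]_y (v (y - x) * f y)%:E)%E.

Local Opaque ball0_potential.

(** An average of v over an interval around -y. *)
Definition mean_density n y : R := ball0_potential P q n y / ball0_weight q n.

Lemma strong_markov_ball0 n x (S : Omega R -> \bar R) A :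
  measurable_fun setT S -> (forall w, (0 <= S w)%E) ->
  measurable (A : set (Omega R)) ->
  (forall r, F_raw r (A `&` [set w | (S w < r%:E)%E])) ->
  (\int[Px P x]_(w in A) occupation q (ball0 n) (S w) w =
   \int[Px P x]_(w in A)
     (discount q (S w) * ball0_potential P q n (X (fine (S w)) w))%:E)%E.
Proof.
move=> mS S0 mA AS; apply: strong_markov => //.
- exact: measurable_ball0.
- by move=> y; exact: ball0_potentialE.
- by move=> y_ y; exact: (ball0_potential_seq P_levy q0 v_cont v_dens).
Qed.

Lemma F_raw_cst_time t A r : F_rawplus t A ->
  F_raw r (A `&` [set w : Omega R | (t%:E < r%:E)%E]).
Proof.
move=> tA; have [rt|tr] := leP r t.
  rewrite (_ : _ `&` _ = set0); first exact: F_raw0.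
  by apply/seteqP; split=> // w [_ /=]; rewrite lte_fin ltNge rt.
by rewrite (_ : _ `&` _ = A); [exact: tA|apply/seteqP; split=> // w; case].
Qed.

(** A maximum principle: a path that starts anywhere has to enter the interval
    before it spends time there, so the potential is at most its maximum on the
    closed interval, where v is bounded by compactness. *)
Lemma ball0_potential_le : exists M, 0 <= M /\
  forall n y, ball0_potential P q n y <= ball0_weight q n * M.
Proof.
(* the radius 2 covers z - y for |z| < 1/(n+1) and |y| <= 1/(n+1), for all n *)
have [M [M0 Mv]] := continuous_bounded_on 2 v_cont; exists M; split => // n y.
have w0 : 0 <= ball0_weight q n * M.
  by rewrite mulr_ge0// ltW// ball0_weight_gt0.
have near0 z : `|z| <= n.+1%:R^-1 -> ball0_potential P q n z <= ball0_weight q n * M.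
  move=> zn.
  have /(ball0_potential_bounds P_levy q0 v_cont v_dens (n := n)) :
      forall z', `|z'| < n.+1%:R^-1 -> - M <= v (z' - z) <= M.
    move=> z' z'n; rewrite -ler_norml Mv// (le_trans (ler_normB _ _))//.
    have n1 : n.+1%:R^-1 <= 1 :> R by rewrite invf_le1// ler1n.
    by rewrite -[leRHS]/(1 + 1) lerD//; apply: le_trans n1 => //; exact: ltW.
  by move=> /andP[].
rewrite -lee_fin ball0_potentialE// potentialE//; last exact: measurable_ball0.
under eq_integral do rewrite (occupation_hit 0 n _ q0).
rewrite strong_markov_ball0//; last 3 first.
- exact: measurable_hit.
- by move=> w; exact: hit_ge.
- by move=> r; apply: F_raw_hit => //; exact: F_rawplusT.
rewrite -[leRHS]mule1 -(@probability_setT _ _ _ (Px P y)) -integral_cst//.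
apply: ge0_le_integral => //.
- by move=> w _; rewrite lee_fin mulr_ge0 ?discount_ge0 ?ball0_potential_ge0.
- apply/measurable_EFinP; apply: measurable_funM.
    by apply: measurableT_comp; [exact: measurable_discount|exact: measurable_hit].
  apply: measurableT_comp; first exact: measurable_ball0_potential.
  by apply: measurable_X_at; exact: measurable_hit.
- move=> w _; rewrite lee_fin /=; case E : (hit 0 n w) => [r| |] /=; last 2 first.
  + by rewrite mul0r.
  + by rewrite mul0r.
  have r0 : 0 <= r by rewrite -lee_fin -E hit_ge.
  rewrite (@le_trans _ _ (1 * ball0_potential P q n (X r w)))//.
    by rewrite ler_wpM2r ?ball0_potential_ge0// (@discount_le1 _ q r%:E)// ltW.
  by rewrite mul1r near0// (norm_X_hit E).
Qed.

Lemma mean_density_bounded : exists M, 0 <= M /\ forall n y, 0 <= mean_density n y <= M.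
Proof.
have [M [M0 hM]] := ball0_potential_le; exists M; split => // n y.
have w0 := ball0_weight_gt0 q0 n.
apply/andP; split; first by rewrite divr_ge0 ?ball0_potential_ge0// ltW.
by rewrite /mean_density ler_pdivrMr// mulrC.
Qed.

Lemma mean_density_cvg (y_ : R^nat) y : y_ n @[n --> \oo] --> y ->
  mean_density n (y_ n) @[n --> \oo] --> v (- y).
Proof. exact: (ball0_potential_cvg P_levy q0 v_cont v_dens). Qed.

Lemma mean_density_cvg_cst y : mean_density n y @[n --> \oo] --> v (- y).
Proof. by apply: (@mean_density_cvg (fun=> y)); exact: cvg_cst. Qed.

Lemma v_bounds : exists M, 0 <= M /\ forall y, 0 <= v y <= M.
Proof.
have [M [M0 aM]] := mean_density_bounded; exists M; split => // y.
have := @mean_density_cvg_cst (- y); rewrite opprK => ay.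
rewrite -(cvg_lim _ ay)//; apply/andP; split.
  apply: limr_ge; first exact: cvgP ay.
  by apply: nearW => n; have /andP[] := aM n (- y).
apply: limr_le; first exact: cvgP ay.
by apply: nearW => n; have /andP[] := aM n (- y).
Qed.

Lemma measurable_mean_density n : measurable_fun setT (mean_density n).
Proof. by apply: measurable_funM => //; exact: measurable_ball0_potential. Qed.

Lemma measurable_v : measurable_fun setT v.
Proof. exact: continuous_measurable_fun. Qed.

Lemma measurable_vN : measurable_fun setT (fun z : R => v (- z)).
Proof.
exact: (measurableT_comp measurable_v (measurable_funN (@measurable_id _ R setT))).
Qed.

Lemma mean_density_integral_eq (A : set (Omega R)) x n (f g : Omega R -> R)
    (Y Z : Omega R -> R) : measurable A ->
  measurable_fun setT f -> measurable_fun setT g ->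
  measurable_fun setT Y -> measurable_fun setT Z ->
  (forall w, 0 <= f w) -> (forall w, 0 <= g w) ->
  (\int[Px P x]_(w in A) (f w * ball0_potential P q n (Y w))%:E =
   \int[Px P x]_(w in A) (g w * ball0_potential P q n (Z w))%:E)%E ->
  (\int[Px P x]_(w in A) (f w * mean_density n (Y w))%:E =
   \int[Px P x]_(w in A) (g w * mean_density n (Z w))%:E)%E.
Proof.
move=> mA mf mg mY mZ f0 g0 fg.
have scale (h U : Omega R -> R) : measurable_fun setT h ->
    measurable_fun setT U -> (forall w, 0 <= h w) ->
    (\int[Px P x]_(w in A) (h w * mean_density n (U w))%:E =
     ((ball0_weight q n)^-1)%:E *
     \int[Px P x]_(w in A) (h w * ball0_potential P q n (U w))%:E)%E.
  move=> mh mU h0; transitivity (\int[Px P x]_(w in A)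
      (((ball0_weight q n)^-1)%:E * (h w * ball0_potential P q n (U w))%:E))%E.
    by apply: eq_integral => w _; rewrite -EFinM /mean_density mulrA mulrC.
  apply: ge0_integralZl.
  - exact: mA.
  - apply/measurable_EFinP; apply: measurable_funTS; apply: measurable_funM; first exact: mh.
    exact: (measurableT_comp (measurable_ball0_potential P q0 n) mU).
  - move=> w _; rewrite lee_fin; apply: mulr_ge0; first exact: h0.
    exact: ball0_potential_ge0.
  - by rewrite lee_fin invr_ge0; apply: ltW; exact: ball0_weight_gt0.
by rewrite (scale f Y mf mY f0) (scale g Z mg mZ g0) fg.
Qed.

Local Opaque mean_density.

(** Both sides are limits of the normalised expected time spent in [ball0 n]
    after t, the left one by the Markov property at t, the right one by the
    strong Markov property at the hitting time of [ball0 n]. *)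
Lemma hitting_identity x t A : 0 <= t -> F_rawplus t A ->
  (\int[Px P x]_(w in A) (expR (- q * t) * v (- X t w))%:E =
   \int[Px P x]_(w in A) (discount q (hit_limit t w) * v 0)%:E)%E.
Proof.
move=> t0 tA; have mA := F_rawplus_measurable tA.
have mX_hit n : measurable_fun setT (fun w => X (fine (hit t n w)) w).
  by apply: measurable_X_at; exact: measurable_hit.
have mlap n : measurable_fun setT (fun w => discount q (hit t n w)).
  by apply: measurableT_comp; [exact: measurable_discount|exact: measurable_hit].
have E n : (\int[Px P x]_(w in A) (expR (- q * t) * mean_density n (X t w))%:E =
    \int[Px P x]_(w in A)
      (discount q (hit t n w) * mean_density n (X (fine (hit t n w)) w))%:E)%E.
  apply: (@mean_density_integral_eq A x n (fun=> expR (- q * t)) (fun w => discount q (hit t n w))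
    (X t) (fun w => X (fine (hit t n w)) w)).
  - exact: mA.
  - exact: measurable_cst.
  - exact: mlap.
  - exact: measurable_X.
  - exact: mX_hit.
  - by move=> w; exact: expR_ge0.
  - by move=> w; exact: discount_ge0.
  transitivity (\int[Px P x]_(w in A) occupation q (ball0 n) t%:E w)%E.
    by rewrite (@strong_markov_ball0 n x (fun=> t%:E))// => r; exact: F_raw_cst_time.
  under eq_integral do rewrite (occupation_hit t n _ q0).
  rewrite (@strong_markov_ball0 n x (hit t n))//.
  - exact: measurable_hit.
  - by move=> w; rewrite (le_trans _ (hit_ge t n w))// lee_fin.
  - by move=> r; exact: F_raw_hit.
have [M [M0 aM]] := mean_density_bounded.
have a0 n y : 0 <= mean_density n y by have /andP[] := aM n y.
have ale n y : mean_density n y <= M by have /andP[] := aM n y.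
have lhs : (\int[Px P x]_(w in A) (expR (- q * t) * mean_density n (X t w))%:E
    @[n --> \oo] -->
    \int[Px P x]_(w in A) (expR (- q * t) * v (- X t w))%:E)%E.
  apply: (@bounded_cvg _ _ _ (Px P x) A _ _ (expR (- q * t) * M)) => //.
  - move=> n; apply: measurable_funTS; apply: measurable_funM => //.
    by apply: measurableT_comp; [exact: measurable_mean_density|exact: measurable_X].
  - by move=> w _; apply: cvgMr; exact: mean_density_cvg_cst.
  - move=> n w _; rewrite ger0_norm; last by rewrite mulr_ge0// expR_ge0.
    by rewrite ler_wpM2l ?expR_ge0.
have rhs : (\int[Px P x]_(w in A)
      (discount q (hit t n w) * mean_density n (X (fine (hit t n w)) w))%:E
    @[n --> \oo] --> \int[Px P x]_(w in A) (discount q (hit_limit t w) * v 0)%:E)%E.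
  apply: (@bounded_cvg _ _ _ (Px P x) A _ _ M) => //.
  - move=> n; apply: measurable_funTS; apply: measurable_funM => //.
    by apply: measurableT_comp => //; exact: measurable_mean_density.
  - move=> w _; have lcvg := discount_hit_cvg (w := w) q0 t0.
    case h : (hit_limit t w) => [r| |].
    + apply: cvgM; first by rewrite -h.
      by rewrite -oppr0; apply: mean_density_cvg; exact: X_hit_cvg h.
    + rewrite /= mul0r.
      apply: (@squeeze_cvgr _ _ _ _ (fun=> 0) (fun n => discount q (hit t n w) * M)).
      * apply: nearW => n; rewrite mulr_ge0 ?discount_ge0//=.
        by rewrite ler_wpM2l ?discount_ge0.
      * exact: cvg_cst.
      * by rewrite -[X in _ --> X](mul0r M); apply: cvgMl; rewrite h in lcvg.
    + by have := hit_limit_ge t w; rewrite h.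
  - move=> n w _; rewrite ger0_norm; last by rewrite mulr_ge0 ?discount_ge0.
    rewrite -[leRHS]mul1r ler_pM ?discount_ge0// discount_le1 ?(ltW q0)//.
    by rewrite (le_trans _ (hit_ge t n w))// lee_fin.
rewrite (_ : (fun n => _) = (fun n => \int[Px P x]_(w in A)
    (discount q (hit t n w) * mean_density n (X (fine (hit t n w)) w))%:E)%E) in lhs.
  exact: (cvg_unique (@ereal_hausdorff R) lhs rhs).
by apply/funext => n; exact: E.
Qed.

Lemma ae0_of_integral0 d (T : measurableType d)
    (mu : {measure set T -> \bar R}) (f : T -> R) :
  measurable_fun setT f -> (forall z, 0 <= f z) ->
  (\int[mu]_z (f z)%:E = 0)%E -> {ae mu, forall z, f z = 0}.
Proof.
move=> mf f0 If.
have : ae_eq mu setT (EFin \o f) (cst 0%E).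
  have mEf : measurable_fun setT (EFin \o f) by exact/measurable_EFinP.
  apply: (ae_eq_integral_abs mu measurableT mEf).1.
  rewrite -[RHS]If; apply: eq_integral => z _ /=; by rewrite ger0_norm.
by apply: filterS => z /(_ I) [].
Qed.

(** The Laplace transform of the hitting time of 0 under P_y. *)
Lemma v_hitting y : ((v (- y))%:E =
  \int[Px P y]_w (discount q (hit_limit 0 w) * v 0)%:E)%E.
Proof.
rewrite -(@hitting_identity y 0)//; last exact: F_rawplusT.
rewrite -[LHS]mule1 -(@probability_setT _ _ _ (Px P y)) -integral_cst//.
have [M [M0 vM]] := v_bounds.
have v0 z : 0 <= v z by have /andP[] := vM z.
apply: ge0_ae_eq_integral => //.
- apply/measurable_EFinP; apply: measurable_funM => //.
  exact: (measurableT_comp measurable_vN (@measurable_X R 0)).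
- by move=> w _; rewrite lee_fin.
- by move=> w _; rewrite lee_fin mulr_ge0// expR_ge0.
- apply: filterS (ae_start P_levy y) => w Xy _.
  by rewrite Xy mulr0 expR0 mul1r.
Qed.

Lemma measurable_discount_hit_limit t : 0 <= t ->
  measurable_fun setT (fun w => discount q (hit_limit t w)).
Proof.
by move=> t0; apply: measurableT_comp; [exact: measurable_discount|exact: measurable_hit_limit].
Qed.

Lemma discount_hit_limit01 t w : 0 <= t -> 0 <= discount q (hit_limit t w) <= 1.
Proof.
move=> t0; rewrite discount_ge0 discount_le1 ?(ltW q0)//.
by rewrite (le_trans _ (hit_limit_ge t w))// lee_fin.
Qed.

Lemma v_ge0 y : 0 <= v y.
Proof. by have [M [_ /(_ y)/andP[]]] := v_bounds. Qed.

Lemma v_le0 y : v y <= v 0.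
Proof.
rewrite -lee_fin -(opprK y) v_hitting.
rewrite -[leRHS]mule1 -(@probability_setT _ _ _ (Px P (- y))) -integral_cst//.
apply: ge0_le_integral => //.
- by move=> w _; rewrite lee_fin mulr_ge0 ?discount_ge0 ?v_ge0.
- by apply/measurable_EFinP; apply: measurable_funM => //; exact: measurable_discount_hit_limit.
- move=> w _; rewrite lee_fin ler_piMl ?v_ge0//.
  by have /andP[] := discount_hit_limit01 w (lexx 0).
Qed.

(** Otherwise v would vanish identically, by [v_le0], whereas q times its
    integral is the total mass 1 of the exponential law. *)
Lemma v0_gt0 : 0 < v 0.
Proof.
rewrite lt_neqAle v_ge0 andbT; apply/negP => /eqP v00.
have v0 y : v y = 0.
  by apply/eqP; rewrite eq_le v_ge0 v00 v_le0.
have := potential_dens P_levy q0 v_dens 0 measurableT.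
under [in RHS]eq_integral do rewrite v0 mul0r.
rewrite integral0 mule0 /potential /transition => /eqP; apply/negP.
under eq_integral => s _.
  rewrite (_ : [set w | _] = setT) ?probability_setT ?mule1; last by apply/seteqP.
  over.
by rewrite integral_exponential_pdf.
Qed.

(** By right-continuity the path stays at a distance at least |X_0|/2 from 0 for
    some time. *)
Lemma hit_limit_gt0 w : X 0 w != 0 -> (0 < hit_limit 0 w)%E.
Proof.
move=> X0; have nX0 : 0 < `|X 0 w| / 2 by rewrite divr_gt0// normr_gt0.
have /X_right_near[d [d0 dX]] : \forall y \near X 0 w, `|X 0 w| / 2 < `|y|.
  have /cvgr_gt : `|y| @[y --> X 0 w] --> `|X 0 w| by exact: norm_continuous.
  by apply; rewrite ltr_pdivrMr// ltr_pMr ?normr_gt0// ltr1n.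
pose n := Num.truncn (`|X 0 w| / 2)^-1.
have nX : n.+1%:R^-1 < `|X 0 w| / 2.
  by rewrite invf_plt ?posrE// truncnS_gt.
apply: lt_le_trans (hit_le_limit 0 n w); apply: (@lt_le_trans _ _ d%:E) => //.
apply: le_ereal_inf_tmp => _ [s [s0 Xs] <-]; rewrite lee_fin leNgt.
apply/negP => sd; move: Xs; apply/negP; rewrite -leNgt ltW//.
apply: (lt_trans nX); move: s0; rewrite le_eqVlt => /predU1P[<-|s0].
  by rewrite ltr_pdivrMr// ltr_pMr ?normr_gt0// ltr1n.
by apply: dX => //; rewrite add0r.
Qed.

(** Equality would make the discount equal to 1 almost surely in [v_hitting],
    that is, would make 0 be hit at time 0. *)
Lemma v_lt0 y : y != 0 -> v (- y) < v 0.
Proof.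
move=> y0; rewrite lt_neqAle v_le0 andbT; apply/negP => /eqP vy.
have mlap := measurable_discount_hit_limit (lexx 0).
have I1 : (\int[Px P y]_w (1 - discount q (hit_limit 0 w))%:E = 0)%E.
  have := v_hitting y; rewrite vy.
  under eq_integral do rewrite mulrC EFinM.
  rewrite ge0_integralZl//; last 3 first.
  - exact/measurable_EFinP.
  - by move=> w _; rewrite lee_fin discount_ge0.
  - by rewrite lee_fin v_ge0.
  move=> E; have {E} lap1 : (\int[Px P y]_w (discount q (hit_limit 0 w))%:E = 1)%E.
    have : ((v 0)^-1%:E * (v 0)%:E = (v 0)^-1%:E * ((v 0)%:E *
        \int[Px P y]_w (discount q (hit_limit 0 w))%:E))%E by rewrite -E.
    by rewrite muleA -EFinM mulVf ?mul1e// gt_eqF// v0_gt0.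
  under eq_integral do rewrite EFinB.
  rewrite integralB//; last 2 first.
  - exact: (finite_measure_integrable_cst (Px P y) 1 measurableT).
  - apply: le_integrable (finite_measure_integrable_cst (Px P y) 1 measurableT) => //.
      exact/measurable_EFinP.
    move=> w _ /=; rewrite lee_fin normr1 ger0_norm ?discount_ge0//.
    by have /andP[] := discount_hit_limit01 w (lexx 0).
  rewrite lap1; have -> : (\int[Px P y]_w 1%:E = 1)%E.
    by rewrite integral_cst// mul1e; exact: probability_setT.
  by rewrite subee.
have : {ae Px P y, forall w, 1 - discount q (hit_limit 0 w) = 0}.
  apply: ae0_of_integral0 => //; first exact: measurable_funB.
  by move=> w; rewrite subr_ge0; have /andP[] := discount_hit_limit01 w (lexx 0).
move=> lap1; have : {ae Px P y, forall w, False}.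
  apply: filterS2 lap1 (ae_start P_levy y) => w lap1 Xy.
  have : (0 < hit_limit 0 w)%E by apply: hit_limit_gt0; rewrite Xy.
  move/eqP: lap1; rewrite subr_eq0 => /eqP.
  case: (hit_limit 0 w) => [r| |] //= lap1; last by move/eqP: lap1; rewrite oner_eq0.
  rewrite lte_fin => r0; have : expR (- q * r) < 1.
    by rewrite expR_lt1 mulNr oppr_lt0 mulr_gt0.
  by rewrite -lap1 ltxx.
move=> [N [mN N0 FN]]; have : Px P y N = 1%E.
  by rewrite (_ : N = setT) ?probability_setT//; apply/seteqP; split=> w // _; exact: FN.
by rewrite N0 => /esym/eqP; rewrite onee_eq0.
Qed.

(** Quasi-left-continuity at the limit T of the hitting times T_n, obtained from
    the resolvent: the expected occupation of a fixed interval after T_n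
    converges to the one after T, which by the strong Markov property gives
    E [e^(-qT) f (X_T)] = E [e^(-qT) f 0] for f the potential of that interval.
    Shrinking the interval replaces f by y |-> v (-y), which attains its maximum
    at 0 only. *)
Lemma X_hit_limit x t : 0 <= t ->
  {ae Px P x, forall w r, hit_limit t w = r%:E -> X r w = 0}.
Proof.
move=> t0.
have mlap := measurable_discount_hit_limit t0.
have mX : measurable_fun setT (fun w => X (fine (hit_limit t w)) w).
  by apply: measurable_X_at; exact: measurable_hit_limit.
have [M [M0 aM]] := mean_density_bounded.
have a0 n y : 0 <= mean_density n y by have /andP[] := aM n y.
have ale n y : mean_density n y <= M by have /andP[] := aM n y.
have E k : (\int[Px P x]_w
     (discount q (hit_limit t w) * ball0_potential P q k (X (fine (hit_limit t w)) w))%:E =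
   \int[Px P x]_w (discount q (hit_limit t w) * ball0_potential P q k 0)%:E)%E.
  have mk := measurable_ball0 k.
  transitivity (\int[Px P x]_w occupation q (ball0 k) (hit_limit t w) w)%E.
    rewrite strong_markov_ball0//.
    - exact: measurable_hit_limit.
    - by move=> w; rewrite (le_trans _ (hit_limit_ge t w))// lee_fin.
    - by move=> r; apply: F_raw_hit_limit => //; exact: F_rawplusT.
  have lhs : (\int[Px P x]_w occupation q (ball0 k) (hit t n w) w @[n --> \oo]
      --> \int[Px P x]_w occupation q (ball0 k) (hit_limit t w) w)%E.
    apply: (@dominated_cvg _ _ _ (Px P x) setT measurableT _ _ (fun=> 1%E)).
    - by move=> n; apply: measurable_occupation => //; exact: measurable_hit.
    - move=> w _; apply: (occupation_cvg (r := fine (hit_limit t w))) => //.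
      move=> s sh.
      have [hs|sh'] := ltP (hit_limit t w) s%:E.
        apply: cvg_near_cst; apply: nearW => n.
        by rewrite (le_lt_trans (hit_le_limit t n w)).
      have sh2 : (s%:E < hit_limit t w)%E.
        rewrite lt_neqAle sh' andbT; apply/negP => /eqP h.
        by move: sh; rewrite -h /= eqxx.
      have [_ [n _ <-] sn] := ereal_sup_gt sh2.
      apply: cvg_near_cst; exists n => // m /= nm; apply/eqP.
      by rewrite ltNge (le_trans (ltW sn))//; exact: hit_nondecreasing.
    - by [].
    - exact: (finite_measure_integrable_cst (Px P x) 1 measurableT).
    - by move=> n w _; rewrite gee0_abs ?occupation_ge0// occupation_le1.
  apply: (cvg_unique (@ereal_hausdorff R) lhs).
  rewrite (_ : (fun n => _) = (fun n => \int[Px P x]_w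
    (discount q (hit t n w) * ball0_potential P q k (X (fine (hit t n w)) w))%:E)%E).
    have hs1 y : ball0_potential P q k y <= 1.
      by rewrite -lee_fin ball0_potentialE// potential_le1.
    apply: (@bounded_cvg _ _ _ (Px P x) setT _ _ 1) => //.
    - move=> n; apply: measurable_funM.
        by apply: measurableT_comp; [exact: measurable_discount|exact: measurable_hit].
      apply: measurableT_comp; first exact: measurable_ball0_potential.
      by apply: measurable_X_at; exact: measurable_hit.
    - move=> w _; have lcvg := discount_hit_cvg (w := w) q0 t0.
      case h : (hit_limit t w) => [r| |].
      + apply: cvgM; first by rewrite -h.
        apply: (ball0_potential_seq P_levy q0 v_cont v_dens); exact: X_hit_cvg h.
      + rewrite /= mul0r.
        apply: (@squeeze_cvgr _ _ _ _ (fun=> 0) (fun n => discount q (hit t n w))).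
        * apply: nearW => n; rewrite mulr_ge0 ?discount_ge0 ?ball0_potential_ge0//=.
          by rewrite ler_piMr ?discount_ge0.
        * exact: cvg_cst.
        * by rewrite h in lcvg.
      + by have := hit_limit_ge t w; rewrite h.
    - move=> n w _; rewrite ger0_norm; last by rewrite mulr_ge0 ?discount_ge0 ?ball0_potential_ge0.
      rewrite mulr_ile1 ?discount_ge0 ?ball0_potential_ge0// discount_le1 ?(ltW q0)//.
      by rewrite (le_trans _ (hit_ge t n w))// lee_fin.
  apply/funext => n; rewrite (@strong_markov_ball0 k x (hit t n))//.
  - exact: measurable_hit.
  - by move=> w; rewrite (le_trans _ (hit_ge t n w))// lee_fin.
  - by move=> r; apply: F_raw_hit => //; exact: F_rawplusT.
have Ea k : (\int[Px P x]_w
     (discount q (hit_limit t w) * mean_density k (X (fine (hit_limit t w)) w))%:E =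
   \int[Px P x]_w (discount q (hit_limit t w) * mean_density k 0)%:E)%E.
  apply: (@mean_density_integral_eq setT x k (fun w => discount q (hit_limit t w))
    (fun w => discount q (hit_limit t w)) (fun w => X (fine (hit_limit t w)) w)
    (fun=> 0)).
  - exact: measurableT.
  - exact: mlap.
  - exact: mlap.
  - exact: mX.
  - exact: measurable_cst.
  - by move=> w; exact: discount_ge0.
  - by move=> w; exact: discount_ge0.
  - exact: E.
have Ev : (\int[Px P x]_w
     (discount q (hit_limit t w) * v (- X (fine (hit_limit t w)) w))%:E =
   \int[Px P x]_w (discount q (hit_limit t w) * v (- 0))%:E)%E.
  have cvgY (Y : Omega R -> R) : measurable_fun setT Y ->
      (\int[Px P x]_w (discount q (hit_limit t w) * mean_density k (Y w))%:E @[k --> \oo] -->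
       \int[Px P x]_w (discount q (hit_limit t w) * v (- Y w))%:E)%E.
    move=> mY; apply: (@bounded_cvg _ _ _ (Px P x) setT _ _ M) => //.
    - move=> k; apply: measurable_funM => //.
      by apply: measurableT_comp => //; exact: measurable_mean_density.
    - by move=> w _; apply: cvgMr; exact: mean_density_cvg_cst.
    - move=> k w _; rewrite ger0_norm; last by rewrite mulr_ge0 ?discount_ge0.
      rewrite -[leRHS]mul1r ler_pM ?discount_ge0//.
      by have /andP[] := discount_hit_limit01 w t0.
  have c1 := cvgY _ mX.
  have c2 := cvgY (fun=> 0) (measurable_cst _).
  rewrite (_ : (fun n => _) = (fun k => \int[Px P x]_w
      (discount q (hit_limit t w) * mean_density k 0)%:E)%E) in c1.
    exact: (cvg_unique (@ereal_hausdorff R) c1 c2).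
  by apply/funext => k; exact: Ea.
have : {ae Px P x, forall w,
    discount q (hit_limit t w) * (v 0 - v (- X (fine (hit_limit t w)) w)) = 0}.
  have mvX : measurable_fun setT (fun w => v (- X (fine (hit_limit t w)) w)).
    exact: (measurableT_comp measurable_vN mX).
  have int_bdd (Y : Omega R -> R) : measurable_fun setT Y ->
      (forall w, 0 <= Y w <= v 0) ->
      (Px P x).-integrable setT (fun w => (discount q (hit_limit t w) * Y w)%:E).
    move=> mY Yv.
    apply: le_integrable (finite_measure_integrable_cst (Px P x) (v 0) measurableT) => //.
      by apply/measurable_EFinP; exact: measurable_funM.
    move=> w _ /=; have /andP[Y0 Yle] := Yv w; rewrite lee_fin.
    rewrite !ger0_norm ?v_ge0 ?mulr_ge0 ?discount_ge0//.
    rewrite -[leRHS]mul1r ler_pM ?discount_ge0//.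
    by have /andP[] := discount_hit_limit01 w t0.
  apply: ae0_of_integral0.
  - by apply: measurable_funM => //; exact: measurable_funB.
  - by move=> w; rewrite mulr_ge0 ?discount_ge0// subr_ge0 v_le0.
  - under eq_integral do rewrite mulrBr EFinB.
    rewrite integralB//; last 2 first.
    + by apply: int_bdd => // w; rewrite v_ge0 lexx.
    + by apply: int_bdd => // w; rewrite v_ge0 v_le0.
    rewrite Ev oppr0 subee//; apply: integrable_fin_num => //.
    by apply: int_bdd => // w; rewrite v_ge0 lexx.
apply: filterS => w + r hr; rewrite hr /= => /eqP.
rewrite mulf_eq0 gt_eqF ?expR_gt0//= subr_eq0 => /eqP v0X.
apply: contrapT => /eqP Xr0; have := v_lt0 Xr0.
by rewrite -v0X ltxx.
Qed.

End hitting_law.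

(** * The first zero and the completed law *)

Section first_zero.
Context {R : realType}.
Implicit Types (w : Omega R) (r s t : R).

(** If 0 is not approached before t, then no interval [ball0 n] with n large is
    visited before t, and the hitting times after 0 and after t coincide. *)
Lemma hit_limit_shift t w : 0 <= t -> (t%:E < hit_limit 0 w)%E ->
  hit_limit t w = hit_limit 0 w.
Proof.
move=> t0 th; apply/eqP; rewrite eq_le; apply/andP; split; last first.
  apply: ge_ereal_sup => _ [n _ <-]; apply: le_trans (hit_le_limit t n w).
  apply: le_ereal_inf_tmp => _ [s [ts Xs] <-].
  by apply: hit_le => //; exact: le_trans ts.
have [_ [m _ <-] tm] := ereal_sup_gt th.
apply: ge_ereal_sup => _ [n _ <-].
apply: (@le_trans _ _ (hit t (maxn m n) w)).
  by apply: hit_nondecreasing; exact: leq_maxr.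
apply: le_trans (hit_le_limit 0 (maxn m n) w).
have tmn : (t%:E < hit 0 (maxn m n) w)%E.
  by apply: lt_le_trans tm _; apply: hit_nondecreasing; exact: leq_maxl.
apply: le_ereal_inf_tmp => _ [s [s0 Xs] <-]; apply: hit_le => //.
by rewrite -lee_fin ltW// (lt_le_trans tmn)// hit_le.
Qed.

Lemma T_0_hit_limit w : ~ dead w -> X 0 w != 0 ->
  (forall r, hit_limit 0 w = r%:E -> X r w = 0) -> T_0 w = hit_limit 0 w.
Proof.
move=> nd X0 Xlim; apply/eqP; rewrite eq_le; apply/andP; split; last first.
  apply: le_ereal_inf_tmp => _ [s [s0 ws] <-].
  apply: ge_ereal_sup => _ [n _ <-]; apply: hit_le; first exact: ltW.
  by rewrite /X /at_coord ws /= normr0 invr_gt0.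
have := hit_limit_gt0 X0; case E : (hit_limit 0 w) => [r| |] //; last first.
  by rewrite leey.
rewrite lte_fin => r0; apply: ereal_inf_lbound; exists r => //; split => //.
by rewrite (alive_X nd (ltW r0)) Xlim.
Qed.

End first_zero.

Section completion.
Context {R : realType} (P : probability (Omega R) R) (x : R).

Lemma cPxE (A : set (Omega R)) : measurable A -> cPx P x A = Px P x A.
Proof. exact: measurable_mu_extE. Qed.

Lemma measurable_cOmega (A : set (Omega R)) : measurable A ->
  measurable (A : set (cOmega P x)).
Proof. exact: caratheodory_measurable_mu_ext. Qed.

(** Functions that are almost everywhere equal to a measurable one need not be
    measurable on the path space; they are so for the completed law, with the
    same integral.  This is how T_0 and the events of [F_t] enter. *)
Lemma ge0_integral_cPx (f : Omega R -> \bar R) (g : cOmega P x -> \bar R) :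
  measurable_fun setT f -> (forall w, 0 <= f w)%E -> (forall w, 0 <= g w)%E ->
  {ae Px P x, forall w, g w = f w} ->
  (\int[cPx P x]_w g w = \int[Px P x]_w f w)%E.
Proof.
move=> mf f0 g0 gf.
have mid : measurable_fun setT (idfun : cOmega P x -> Omega R).
  by move=> _ A mA; rewrite setTI; exact: measurable_cOmega.
have mf' : measurable_fun setT (f : cOmega P x -> \bar R).
  exact: (measurableT_comp mf mid).
have fg : ae_eq (cPx P x) setT (f : cOmega P x -> \bar R) g.
  have [N [mN N0 gfN]] := gf; exists N; split.
  - exact: measurable_cOmega.
  - by rewrite cPxE.
  - by move=> w /= fg; apply: gfN => /= gfw; apply: fg.
transitivity (\int[cPx P x]_w f w)%E.
  apply: ge0_ae_eq_integral.
  - exact: measurableT.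
  - apply: (ae_measurable_fun _ fg mf').
    exact: measure_is_complete_caratheodory.
  - exact: mf'.
  - by move=> w _; exact: g0.
  - by move=> w _; exact: f0.
  - exact: ae_eq_sym fg.
transitivity (\int[pushforward (cPx P x) (idfun : cOmega P x -> Omega R)]_w f w)%E.
  by rewrite ge0_integral_pushforward.
by apply: eq_measure_integral => A mA _; exact: cPxE.
Qed.

End completion.

(** * The clock and the first zero *)

Section exponential_tail.
Context {R : realType}.
Notation leb := (@lebesgue_measure R).
Variable q : R.
Hypothesis q0 : 0 < q.

Lemma exponential_prob_gt t : 0 <= t ->
  exponential_prob q [set s | t < s] = (expR (- q * t))%:E.
Proof.
move=> t0.
have E : (\int[leb]_s (exponential_pdf q s * ((t < s)%R%:R * cst 1 s))%:E =
    (expR (- q * t))%:E)%E.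
  rewrite (integral_exponential_pdf_shift q0 t0)//.
  under eq_integral do rewrite mulr1.
  by rewrite integral_exponential_pdf// mule1.
rewrite -E.
rewrite /exponential_prob integral_mkcond; apply: eq_integral => s _.
rewrite patchE /cst; have [ts|ts] := boolP (t < s).
  by rewrite mem_set// mul1r mulr1.
by rewrite memNset ?mul0r ?mulr0//=; exact/negP.
Qed.

Lemma exponential_prob_ge t : 0 <= t ->
  exponential_prob q [set s | t <= s] = (expR (- q * t))%:E.
Proof.
move=> t0; rewrite -exponential_prob_gt// /exponential_prob.
rewrite integral_mkcond [RHS]integral_mkcond.
have mge : measurable [set s : R | t <= s].
  by rewrite -[X in measurable X]set_itvcy.
have mgt : measurable [set s : R | t < s].
  by rewrite -[X in measurable X]set_itvoy.
have mpdf : measurable_fun setT (fun s => (exponential_pdf q s)%:E).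
  by apply/measurable_EFinP; exact: measurable_exponential_pdf.
have pdf0 s : (0 <= (exponential_pdf q s)%:E)%E.
  by rewrite lee_fin exponential_pdf_ge0// ltW.
apply: (@ge0_integral_eq_off _ t).
- by apply/(measurable_restrictT _ _).1 => //; exact: measurable_funTS.
- by apply/(measurable_restrictT _ _).1 => //; exact: measurable_funTS.
- by move=> s; apply: erestrict_ge0.
- by move=> s; apply: erestrict_ge0.
- move=> s st; rewrite !patchE; congr (if _ then _ else _).
  apply/idP/idP => /set_mem /= ts; apply/mem_set => /=; last exact: ltW.
  by rewrite lt_neqAle eq_sym st.
Qed.

Context d (W : measurableType d) (Q : probability W R) (e : {RV Q >-> R}).
Hypothesis eE : forall B : set R, measurable B ->
  distribution Q e B = exponential_prob q B.

Lemma clock_gt t : 0 <= t -> Q [set v | t < e v] = (expR (- q * t))%:E.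
Proof.
move=> t0; rewrite -exponential_prob_gt// -eE//.
by rewrite -[X in measurable X]set_itvoy.
Qed.

Lemma clock_ge t : 0 <= t -> Q [set v | t <= e v] = (expR (- q * t))%:E.
Proof.
move=> t0; rewrite -exponential_prob_ge// -eE//.
by rewrite -[X in measurable X]set_itvcy.
Qed.

Lemma measurable_clock_lt t : measurable [set v | t < e v].
Proof.
rewrite (_ : [set v | _] = e @^-1` `]t, +oo[).
  by rewrite -[X in measurable X]setTI; exact: measurable_funP.
by apply/seteqP; split=> v /=; rewrite in_itv/= andbT.
Qed.

Lemma measurable_clock_le t : measurable [set v | t <= e v].
Proof.
rewrite (_ : [set v | _] = e @^-1` `[t, +oo[).
  by rewrite -[X in measurable X]setTI; exact: measurable_funP.
by apply/seteqP; split=> v /=; rewrite in_itv/= andbT.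
Qed.

(** The clock rings between t and T with probability e^(-qt) - e^(-qT). *)
Lemma clock_between t (T : \bar R) : 0 <= t -> (0 <= T)%E ->
  Q [set v | t < e v /\ ((e v)%:E < T)%E] =
  ((t%:E < T)%E%:R * (expR (- q * t) - discount q T))%:E.
Proof.
move=> t0; case: T => [r| |] //=; rewrite ?lee_fin => r0; last first.
  rewrite ltry mul1r subr0 -clock_gt//; congr (Q _).
  by apply/seteqP; split=> v /= => [[]//|tv]; rewrite ltry.
rewrite lte_fin; have [tr|rt] := ltP t r; last first.
  rewrite mul0r (_ : [set _ | _] = set0) ?measure0//.
  apply/seteqP; split=> v //= [tv]; rewrite lte_fin => vr.
  by have := lt_le_trans (lt_trans tv vr) rt; rewrite ltxx.
rewrite mul1r EFinB -clock_gt// -clock_ge//.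
transitivity (Q ([set v | t < e v] `\` [set v | r <= e v])).
  congr (Q _); apply/seteqP; split=> v /= [tv].
    by rewrite lte_fin => vr; split => //; apply/negP; rewrite -ltNge.
  by move/negP; rewrite -ltNge => vr; split => //; rewrite lte_fin.
rewrite measureD/=; last 3 first.
- exact: measurable_clock_lt.
- exact: measurable_clock_le.
- by rewrite clock_gt// ltry.
congr (_ - Q _)%E; apply/seteqP; split=> v /= => [[]//|rv].
by split => //; exact: lt_le_trans rv.
Qed.

Lemma clock_before (T : \bar R) : (0 <= T)%E ->
  Q [set v | ((e v)%:E < T)%E] = (1 - discount q T)%:E.
Proof.
case: T => [r| |] //=; rewrite ?lee_fin => r0; last first.
  rewrite subr0 (_ : [set _ | _] = setT) ?probability_setT//.
  by apply/seteqP; split=> v //= _; rewrite ltry.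
rewrite EFinB -clock_ge// -probability_setC; last exact: measurable_clock_le.
congr (Q _); apply/seteqP; split=> v /=; rewrite lte_fin ltNge; first by move/negP.
by move=> H; exact/negP.
Qed.

End exponential_tail.

Lemma bounded_integrable d (T : measurableType d) (R : realType)
    (mu : probability T R) (E : set T) (f : T -> R) (M : R) : measurable E ->
  measurable_fun setT f -> (forall w, `|f w| <= M) ->
  mu.-integrable E (EFin \o f).
Proof.
move=> mE mf fM.
apply: le_integrable (finite_measure_integrable_cst mu M mE) => //.
  by apply/measurable_EFinP; exact: measurable_funTS.
by move=> w _ /=; rewrite lee_fin (le_trans (fM w))// ler_norm.
Qed.

Section conditioning.
Context {R : realType} (P : probability (Omega R) R) (P_levy : levy_process P).
Implicit Types (w : Omega R) (r s t y : R) (A L : set (cadlag R)).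
Notation leb := (@lebesgue_measure R).
Variables (q : R) (v : R -> R).
Hypotheses (q0 : 0 < q) (v_cont : continuous v).
Hypothesis v_dens : forall (f : R -> R) (x : R), measurable_fun setT f ->
  bounded_fun f ->
  (\int[Px P x]_w \int[leb]_(t in `[0%R, +oo[)
     (expR (- q * t) * at_coord f t w)%:E
   = \int[leb]_y (v (y - x) * f y)%:E)%E.
Variables (x t : R).
Hypotheses (x0 : x != 0) (t0 : 0 <= t).
Context d (W : measurableType d) (Q : probability W R) (e : {RV Q >-> R}).
Hypothesis eE : forall B : set R, measurable B ->
  distribution Q e B = exponential_prob q B.

(** Almost surely the event t < T_0, in a form that is measurable with respect
    to [F_rawplus t]. *)
Definition unhit : set (Omega R) := [set w | (t%:E < hit_limit 0 w)%E].

Lemma F_rawplus_unhit : F_rawplus t unhit.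
Proof. exact: F_rawplus_lt_hit_limit. Qed.

Lemma ae_T_0 : {ae Px P x, forall w, T_0 w = hit_limit 0 w}.
Proof.
have Xl := X_hit_limit P_levy q0 v_cont v_dens x (lexx 0).
apply: filterS3 (ae_alive P_levy x) (ae_start P_levy x) Xl => w nd Xx Xl.
by apply: T_0_hit_limit => //; rewrite Xx.
Qed.

Lemma discount_le (T : \bar R) : (t%:E <= T)%E -> discount q T <= expR (- q * t).
Proof.
case: T => [r| |] //=.
by rewrite lee_fin => tr; rewrite ler_expR !mulNr lerN2 ler_wpM2l// ltW.
Qed.

Let hl0 w : (0 <= hit_limit 0 w)%E := hit_limit_ge 0 w.

(** Integrating out the clock leaves the probability that it rings between t and
    the first zero. *)
Let density A w : R := \1_(A `&` unhit) w * (expR (- q * t) - discount q (hit_limit 0 w)).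

Let density_ge0 A w : 0 <= density A w.
Proof.
rewrite /density indicE; case: (boolP (w \in _)) => [/set_mem [_ tw]|_].
  by rewrite mul1r subr_ge0; apply: discount_le; exact: ltW.
by rewrite mul0r.
Qed.

Let m_lap : measurable_fun setT (fun w => discount q (hit_limit 0 w)).
Proof. exact: measurable_discount_hit_limit. Qed.

Let m_density A : F_rawplus t A -> measurable_fun setT (density A).
Proof.
move=> tA; apply: measurable_funM; last by apply: measurable_funB.
apply: measurable_indic; apply: (@F_rawplus_measurable _ t).
by apply: F_rawplusI => //; exact: F_rawplus_unhit.
Qed.

Let numE A L : F_rawplus t A -> {ae Px P x, forall w, L w <-> A w} ->
  ((cPx P x \x Q) ([set w | L w.1 /\ (t < e w.2)%R] `&`
    [set w | ((e w.2)%:E < T_0 w.1)%E]) =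
   \int[Px P x]_w (density A w)%:E)%E.
Proof.
move=> tA LA; rewrite /product_measure1; apply: ge0_integral_cPx.
- by apply/measurable_EFinP; exact: m_density.
- by move=> w; rewrite lee_fin density_ge0.
- by move=> w; exact: measure_ge0.
apply: filterS2 LA ae_T_0 => w LA Tw /=.
rewrite /density indicE.
transitivity (Q [set z | A w /\ (t < e z /\ ((e z)%:E < hit_limit 0 w)%E)]).
  congr (Q _); apply/seteqP; split=> z; rewrite /xsection /= ?inE /= Tw.
    by move=> [[/LA ? ?] ?].
  by move=> [/LA ? [? ?]].
have [/set_mem Aw|Aw] := boolP (w \in A); last first.
  rewrite memNset ?mul0r; last by move=> [Aw' _]; move/negP: Aw; apply; exact/mem_set.
  rewrite (_ : [set _ | _] = set0) ?measure0//; apply/seteqP; split=> z //=.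
  by move=> [Aw' _]; move/negP: Aw; apply; exact/mem_set.
transitivity (Q [set z | t < e z /\ ((e z)%:E < hit_limit 0 w)%E]).
  by congr (Q _); apply/seteqP; split=> z /= => [[]|].
rewrite (clock_between q0 eE)//; congr ((_ * _)%:E).
have [tw|tw] := boolP (t%:E < hit_limit 0 w)%E; first by rewrite mem_set.
by rewrite memNset// => -[_ tw']; move/negP: tw; apply.
Qed.

Let denE : ((cPx P x \x Q) [set w | ((e w.2)%:E < T_0 w.1)%E] =
   \int[Px P x]_w (1 - discount q (hit_limit 0 w))%:E)%E.
Proof.
rewrite /product_measure1; apply: ge0_integral_cPx.
- by apply/measurable_EFinP; exact: measurable_funB.
- move=> w; rewrite lee_fin subr_ge0.
  by have /andP[] := discount_hit_limit01 q0 w (lexx 0).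
- by move=> w; exact: measure_ge0.
apply: filterS ae_T_0 => w Tw /=; rewrite -(clock_before q0 eE)//.
by congr (Q _); apply/seteqP; split=> z; rewrite /xsection /= ?inE /= Tw.
Qed.

(** E_x [H_q (X_t); A, t < T_0] with H_q y = u_q 0 - u_q (-y). *)
Definition excess A : R := \int[Px P x]_(w in A `&` unhit) (v 0 - v (- X t w)).

Let v_gt0 : 0 < v 0 := v0_gt0 P_levy q0 v_cont v_dens.

Let v_range y : 0 <= v y <= v 0.
Proof.
by rewrite (v_ge0 P_levy q0 v_cont v_dens) (v_le0 P_levy q0 v_cont v_dens).
Qed.

Let m_vX : measurable_fun setT (fun w : Omega R => v (- X t w)).
Proof. exact: (measurableT_comp (measurable_vN v_cont) (@measurable_X R t)). Qed.

(** On the event [unhit] the hitting times of 0 after 0 and after t agree, so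
    that [hitting_identity] at time t evaluates the discount. *)
Let integral_density A : F_rawplus t A ->
  (\int[Px P x]_w (density A w)%:E = (expR (- q * t) / v 0 * excess A)%:E)%E.
Proof.
move=> tA; set E : set (Omega R) := A `&` unhit.
have tE : F_rawplus t E by apply: F_rawplusI => //; exact: F_rawplus_unhit.
have mE : measurable E := F_rawplus_measurable tE.
have ml : measurable_fun setT (fun w => discount q (hit_limit t w)).
  exact: measurable_discount_hit_limit.
have l01 w := discount_hit_limit01 q0 w t0.
have cst_int c : (Px P x).-integrable E (EFin \o (fun=> c)).
  exact: finite_measure_integrable_cst.
have lap_int : (Px P x).-integrable E (EFin \o (fun w => discount q (hit_limit t w))).
  apply: (@bounded_integrable _ _ _ _ _ _ 1) => // w.
  by have /andP[? ?] := l01 w; rewrite ger0_norm.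
have vX_int : (Px P x).-integrable E (EFin \o (fun w => v (- X t w))).
  apply: (@bounded_integrable _ _ _ _ _ _ (v 0)) => // w.
  by have /andP[? ?] := v_range (- X t w); rewrite ger0_norm.
transitivity (\int[Px P x]_(w in E) (expR (- q * t) - discount q (hit_limit t w))%:E)%E.
  rewrite [RHS]integral_mkcond; apply: eq_integral => w _.
  rewrite patchE /density indicE -/E; case: ifPn => wE; last by rewrite mul0r.
  by move/set_mem : wE => [_ tw]; rewrite mul1r hit_limit_shift.
have fin : (\int[Px P x]_(w in E) (expR (- q * t) - discount q (hit_limit t w))%:E)%E
    \is a fin_num.
  apply: integrable_fin_num => //.
  rewrite (_ : (fun w => _) = (EFin \o (fun=> expR (- q * t))) \-
    (EFin \o (fun w => discount q (hit_limit t w))))%E; last exact/funext.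
  exact: integrableB.
rewrite -(fineK fin); congr EFin.
rewrite -[LHS]/(\int[Px P x]_(w in E) (expR (- q * t) - discount q (hit_limit t w))).
rewrite RintegralB//.
have /(congr1 fine) := hitting_identity P_levy q0 v_cont v_dens x t0 tE.
rewrite -[fine (\int[Px P x]_(w in E) (discount q (hit_limit t w) * v 0)%:E)%E]/(
  \int[Px P x]_(w in E) (discount q (hit_limit t w) * v 0)).
rewrite -[fine (\int[Px P x]_(w in E) _)%E]/(
  \int[Px P x]_(w in E) (expR (- q * t) * v (- X t w))).
rewrite RintegralZl// RintegralZr// => h.
rewrite /excess -/E RintegralB// !Rintegral_cst//.
apply: (mulIf (lt0r_neq0 v_gt0)).
rewrite [RHS]mulrAC divfK ?gt_eqF// mulrBl -h mulrBr; congr (_ - _).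
by rewrite mulrA mulrAC.
Qed.

Let integral_discount :
  (\int[Px P x]_w (1 - discount q (hit_limit 0 w))%:E = ((v 0 - v (- x)) / v 0)%:E)%E.
Proof.
have l01 w := discount_hit_limit01 q0 w (lexx 0).
have lap_int : (Px P x).-integrable setT (EFin \o (fun w => discount q (hit_limit 0 w))).
  apply: (@bounded_integrable _ _ _ _ _ _ 1) => // w.
  by have /andP[? ?] := l01 w; rewrite ger0_norm.
have /(congr1 fine) := v_hitting P_levy q0 v_cont v_dens x.
rewrite -[fine (\int[Px P x]_w _)%E]/(
  \int[Px P x]_w (discount q (hit_limit 0 w) * v 0)) /= RintegralZr// => ->.
under eq_integral do rewrite EFinB.
rewrite integralB//; last exact: finite_measure_integrable_cst.
rewrite -(fineK (integrable_fin_num _ lap_int))//.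
rewrite -[fine _]/(\int[Px P x]_w (discount q (hit_limit 0 w))).
have -> : (\int[Px P x]_w 1%:E = 1)%E.
  by rewrite integral_cst// mul1e; exact: probability_setT.
rewrite -EFinB; congr EFin.
by rewrite mulrBl divff ?gt_eqF// mulfK ?gt_eqF.
Qed.

(** Ringing between t and the first zero implies ringing before the first
    zero. *)
Lemma excess_le : expR (- q * t) * excess setT <= v 0 - v (- x).
Proof.
have : (\int[Px P x]_w (density setT w)%:E <=
    \int[Px P x]_w (1 - discount q (hit_limit 0 w))%:E)%E.
  apply: ge0_le_integral => //.
  - by move=> w _; rewrite lee_fin density_ge0.
  - by apply/measurable_EFinP; apply: m_density; exact: F_rawplusT.
  - by apply/measurable_EFinP; exact: measurable_funB.
  - move=> w _; rewrite lee_fin /density indicE.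
    have /andP[_ l1] := discount_hit_limit01 q0 w (lexx 0).
    case: (_ \in _); last by rewrite mul0r subr_ge0.
    rewrite mul1r lerD2r -[leRHS]expR0 ler_expR mulNr oppr_le0.
    by rewrite mulr_ge0// ltW.
rewrite integral_density; last exact: F_rawplusT.
by rewrite integral_discount lee_fin mulrAC ler_pM2r ?invr_gt0.
Qed.

(** The factors 1 / u_q 0 of the numerator and of the denominator cancel. *)
Lemma cond_prob_excess A L : F_rawplus t A ->
  {ae Px P x, forall w, L w <-> A w} ->
  cond_prob (cPx P x \x Q)%E
    [set w | L w.1 /\ t < e w.2] [set w | ((e w.2)%:E < T_0 w.1)%E] =
  expR (- q * t) * excess A / (v 0 - v (- x)).
Proof.
move=> tA LA; rewrite /cond_prob (numE tA LA) denE integral_density// integral_discount /=.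
have d0 : v 0 - v (- x) != 0.
  by rewrite subr_eq0 gt_eqF// (v_lt0 P_levy q0 v_cont v_dens).
have v0n : v 0 != 0 by rewrite gt_eqF.
by rewrite invf_div mulrA; congr (_ / _); rewrite mulrAC divfK.
Qed.

End conditioning.

(** * Letting the rate of the clock tend to zero *)

(** Fatou's lemma with a limit instead of a lower limit: the minimum with g is
    dominated by g, and bounds the integral of G_n from below. *)
Lemma Rintegral_min_cvg d (T : measurableType d) (R : realType)
    (mu : {measure set T -> \bar R}) (E : set T) (G : (T -> R)^nat) (g : T -> R) :
  measurable E -> (forall n, measurable_fun setT (G n)) ->
  (forall n w, 0 <= G n w) -> (forall w, G n w @[n --> \oo] --> g w) ->
  mu.-integrable E (EFin \o g) ->
  \int[mu]_(w in E) Num.min (G n w) (g w) @[n --> \oo] -->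
  \int[mu]_(w in E) g w.
Proof.
move=> mE mG G0 Gg gint.
have mg : measurable_fun setT g.
  by apply: (measurable_fun_cvg (h := G)) => // w _; exact: Gg.
have g0 w : 0 <= g w.
  rewrite -(cvg_lim _ (Gg w))//; apply: limr_ge; first exact: cvgP (Gg w).
  exact: nearW.
apply: fine_cvg; rewrite fineK; last exact: integrable_fin_num.
apply: (@dominated_cvg _ _ _ mu E mE _ _ (EFin \o g)).
- move=> n; apply/measurable_EFinP; apply: measurable_funTS.
  exact: measurable_minr.
- move=> w _; apply: cvg_EFin; first exact: nearW.
  apply/cvgrPdist_le => eps eps0.
  have /cvgrPdist_le/(_ _ eps0) := Gg w; apply: filterS => n /=.
  by case: (leP (G n w) (g w)) => // _ _; rewrite subrr normr0 ltW.
- by [].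
- exact: gint.
- by move=> n w _; rewrite lee_fin ger0_norm ?le_min ?G0 ?g0// ge_min lexx orbT.
Qed.

Section conditional_law.
Context {R : realType} (P : probability (Omega R) R) (P_levy : levy_process P).
Implicit Types (w : Omega R) (r s t y : R) (A L : set (cadlag R)).

(** An event of the completed sigma-algebra can be replaced by one of
    [F_rawplus t], as far as P_x is concerned. *)
Lemma F_tP x t L : F_t P t L -> exists A,
  F_rawplus t A /\ {ae Px P x, forall w, L w <-> A w}.
Proof.
move=> /(_ x)[A [B [tA tB AL LB BA0]]]; exists A; split => //.
exists (B `\` A); split => //.
  by apply: measurableD; apply: (@F_rawplus_measurable _ t).
move=> w /= nLA; apply: contrapT => nBA; apply: nLA; split; last exact: AL.
by move=> Lw; apply: contrapT => nA; apply: nBA; split => //; exact: LB.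
Qed.

Lemma F_tT t : F_t P t setT.
Proof.
by move=> x; exists setT, setT; split => //; rewrite ?setDv ?measure0//; exact: F_rawplusT.
Qed.

End conditional_law.

Theorem theorem7 (R : realType) (P : probability (Omega R) R)
    (psi : R -> R[i]) (u : R -> R -> R) (h : R -> R)
    (d : measure_display) (W : measurableType d) (Q : probability W R)
    (e : R -> {RV Q >-> R})
    (P_levy : levy_process P)
    (P_psi : characteristic_exponent P psi)
    (P_regular : regular_for_itself P)
    (P_not_cpp : ~ compound_poisson_process P)
    (int_psi : forall q, 0 < q ->
      (\int[lebesgue_measure]_l ((q + complex.Re (psi l))^-1)%:E < +oo)%E)
    (int_psi1 :
      (\int[lebesgue_measure]_l
         (`|complex.Re ((1 - cexp (Complex 0 l)) / psi l)|)%:E < +oo)%E)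
    (P_u : resolvent_density P u)
    (h_lim : forall x, (u q 0 - u q (- x)) @[q --> 0^'+] --> h x)
    (e_exp : forall q, 0 < q -> forall B : set R, measurable B ->
      distribution Q (e q) B = exponential_prob q B)
    (x : R) (hx : 0 < h x)
    (Pud : probability (F_infty P) R) (P_Pud : conditioned_law h x Pud)
    (t : R) (ht : 0 < t) (L : set (cadlag R)) (hL : F_t P t L) :
  cond_prob (cPx P x \x Q)%E
    [set w | L w.1 /\ t < e q w.2]
    [set w | ((e q w.2)%:E < T_0 w.1)%E] @[q --> 0^'+]
  --> fine (Pud L).
Proof.
have t0 := ltW ht.
have u_cont q (q0 : 0 < q) : continuous (u q) := (P_u q q0).1.
have u_dens q (q0 : 0 < q) := (P_u q q0).2.
have x0 : x != 0.
  apply/eqP => xE; move: hx; rewrite xE.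
  suff -> : h 0 = 0 by rewrite ltxx.
  have := h_lim 0; rewrite oppr0 (_ : (fun q => u q 0 - u q 0) = fun=> 0).
    by move=> H; apply: (cvg_unique (@Rhausdorff R) H); exact: cvg_cst.
  by apply/funext => q; rewrite subrr.
apply/cvg_at_rightP => q_ [q_gt0 q_cvg].
pose H n y := u (q_ n) 0 - u (q_ n) (- y).
have H_cvg y : H n y @[n --> \oo] --> h y.
  by have /cvg_at_rightP := h_lim y; apply.
have H_ge0 n y : 0 <= H n y.
  by rewrite subr_ge0 (v_le0 P_levy (q_gt0 n) (u_cont _ (q_gt0 n)) (u_dens _ (q_gt0 n))).
have mH n : measurable_fun setT (H n).
  apply: measurable_funB => //; apply: measurable_vN; exact: u_cont.
have h_ge0 y : 0 <= h y.
  rewrite -(cvg_lim _ (H_cvg y))//; apply: limr_ge; first exact: cvgP (H_cvg y).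
  exact: nearW.
have mh : measurable_fun setT h.
  by apply: (measurable_fun_cvg (h := H)) => // y _; exact: H_cvg.
have mX := @measurable_X R t.
have mU : measurable (unhit t : set (Omega R)).
  exact: F_rawplus_measurable (F_rawplus_unhit t0).
have T_0E : {ae Px P x, forall w : Omega R, T_0 w = hit_limit 0 w}.
  exact: (ae_T_0 P_levy (q_gt0 0%N) (u_cont _ (q_gt0 0%N)) (u_dens _ (q_gt0 0%N)) x0).
have PudE B A : F_t P t B -> F_rawplus t A ->
    {ae Px P x, forall w : Omega R, B w <-> A w} -> Pud B = ((h x)^-1%:E *
    \int[Px P x]_(w in A `&` unhit t) (h (X t w))%:E)%E.
  move=> tB tA BA; rewrite (P_Pud t B t0 tB); congr (_ * _)%E.
  have mE : measurable (A `&` unhit t : set (Omega R)).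
    by apply: measurableI => //; exact: F_rawplus_measurable tA.
  rewrite [RHS]integral_mkcond; apply: ge0_integral_cPx.
  - apply/(measurable_restrictT _ _).1 => //; apply: measurable_funTS.
    by apply/measurable_EFinP; exact: (measurableT_comp mh mX).
  - by move=> w; apply: erestrict_ge0 => w' _; rewrite lee_fin.
  - move=> w; rewrite lee_fin !mulr_ge0//.
    by rewrite /at_coord; case: (Defs.coord w t) => //= y.
  - apply: filterS3 BA T_0E (ae_alive P_levy x) => w BA Tw nd.
    rewrite patchE /at_coord (alive_X nd t0) /= !indicE.
    rewrite (_ : (w \in [set w' | (t%:E < T_0 w')%E]) = (w \in unhit t)).
      rewrite in_setI (_ : (w \in B) = (w \in A)).
        by case: (w \in A); case: (w \in unhit t); rewrite ?mul1r ?mulr1 ?mul0r ?mulr0.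
      by apply/idP/idP => /set_mem /BA /mem_set.
    by apply/idP/idP => /set_mem H'; apply/mem_set; move: H'; rewrite /unhit /= Tw.
have [A [tA LA]] := F_tP x hL.
have tA' : F_rawplus t (~` A) by exact: F_rawplusC.
have mA : measurable (A : set (Omega R)) := F_rawplus_measurable tA.
pose g w := h (X t w).
have mg : measurable_fun setT g by exact: (measurableT_comp mh mX).
have Ig : (\int[Px P x]_(w in unhit t) (g w)%:E = (h x)%:E)%E.
  have := PudE _ _ (F_tT P t) (@F_rawplusT R t) (aeW _ (fun w => iff_refl _)).
  rewrite setTI (probability_setT Pud) => E.
  have : ((h x)%:E * 1 = (h x)%:E * ((h x)^-1%:E *
      \int[Px P x]_(w in unhit t) (g w)%:E))%E by rewrite -E.
  by rewrite mule1 muleA -EFinM divff ?mul1e ?gt_eqF.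
have g_int : (Px P x).-integrable (unhit t) (EFin \o g).
  apply/integrableP; split.
    by apply/measurable_EFinP; exact: measurable_funTS.
  rewrite (_ : (\int[_]_(w in _) _)%E = (\int[Px P x]_(w in unhit t) (g w)%:E)%E).
    by rewrite Ig ltry.
  by apply: eq_integral => w _ /=; rewrite ger0_norm// /g.
pose G n w := H n (X t w).
have mG n : measurable_fun setT (G n) by exact: (measurableT_comp (mH n) mX).
have part B : measurable (B : set (Omega R)) ->
    measurable (B `&` unhit t : set (Omega R)) by move=> mB; exact: measurableI.
have g_intB B : measurable (B : set (Omega R)) ->
    (Px P x).-integrable (B `&` unhit t) (EFin \o g).
  by move=> mB; apply: integrableS g_int => //; exact: part.
have G_int n B : measurable (B : set (Omega R)) ->
    (Px P x).-integrable (B `&` unhit t) (EFin \o G n).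
  move=> mB; apply: (@bounded_integrable _ _ _ _ _ _ (u (q_ n) 0)) => //.
    exact: part.
  move=> w; rewrite /G ger0_norm ?H_ge0// /H gerBl.
  exact: (v_ge0 P_levy (q_gt0 n) (u_cont _ (q_gt0 n)) (u_dens _ (q_gt0 n))).
pose j B : R := \int[Px P x]_(w in B `&` unhit t) g w.
pose m n B : R := \int[Px P x]_(w in B `&` unhit t) Num.min (G n w) (g w).
pose I n B : R := excess P (u (q_ n)) x t B.
have m_cvg B : measurable (B : set (Omega R)) -> m n B @[n --> \oo] --> j B.
  move=> mB; apply: Rintegral_min_cvg => //.
  - exact: part.
  - by move=> n w; exact: H_ge0.
  - by move=> w; exact: H_cvg.
  - exact: g_intB.
have mI n B : measurable (B : set (Omega R)) -> m n B <= I n B.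
  move=> mB; apply: le_Rintegral.
  - exact: part.
  - apply: le_integrable (G_int n B mB) => //; first exact: part.
      by apply/measurable_EFinP; apply: measurable_funTS; exact: measurable_minr.
    move=> w _ /=; rewrite lee_fin !ger0_norm ?H_ge0//.
      by rewrite ge_min lexx.
    by rewrite le_min H_ge0 /g h_ge0.
  - exact: G_int.
  - by move=> w _; rewrite ge_min lexx.
(* the two complementary events, and the two facts on total masses *)
have split_unhit (f : Omega R -> R) : (Px P x).-integrable (unhit t) (EFin \o f) ->
    \int[Px P x]_(w in unhit t) f w = \int[Px P x]_(w in A `&` unhit t) f w +
    \int[Px P x]_(w in ~` A `&` unhit t) f w.
  move=> fint; rewrite -Rintegral_setU//.
  - by rewrite -setIUl setUv setTI.
  - exact: part.
  - by apply: part; exact: measurableC.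
  - by rewrite -setIUl setUv setTI.
  - by apply/disj_setPS => w [[Aw _] [nAw _]].
have jj : j A + j (~` A) = h x.
  by rewrite /j -split_unhit// /Rintegral Ig.
have II n : I n A + I n (~` A) = I n setT.
  rewrite /I /excess -split_unhit ?setTI//.
  by rewrite -(setTI (unhit t)); exact: G_int.
pose c n : R := expR (- q_ n * t) / H n x.
have H_gt0 n : 0 < H n x.
  by rewrite subr_gt0 (v_lt0 P_levy (q_gt0 n) (u_cont _ (q_gt0 n)) (u_dens _ (q_gt0 n))).
have c_ge0 n : 0 <= c n by rewrite divr_ge0 ?expR_ge0.
have c_cvg : c n @[n --> \oo] --> (h x)^-1.
  rewrite -[X in _ --> X]mul1r; apply: cvgM.
    rewrite -[X in _ --> X]expR0 -(mul0r t) -[in X in _ --> X]oppr0.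
    apply: continuous_cvg; first exact: continuous_expR.
    by apply: cvgMl; apply: cvgN.
  by apply: cvgV; [rewrite gt_eqF|exact: H_cvg].
have total n : c n * I n A + c n * I n (~` A) <= 1.
  rewrite -mulrDr II /c mulrAC ler_pdivrMr// mul1r.
  exact: (excess_le P_levy (q_gt0 n) (u_cont _ (q_gt0 n)) (u_dens _ (q_gt0 n)) x t0).
have -> : fine (Pud L) = (h x)^-1 * j A.
  rewrite (PudE L A hL tA LA) fineM//.
  by apply: integrable_fin_num; [exact: part|exact: g_intB].
(* the quotient for A is bounded below directly, and above through ~` A *)
apply: (@squeeze_cvgr _ _ _ _ (fun n => c n * m n A)
  (fun n => 1 - c n * m n (~` A))).
- apply: nearW => n.
  have -> : cond_prob (cPx P x \x Q)%E [set w | L w.1 /\ t < e (q_ n) w.2]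
      [set w | ((e (q_ n) w.2)%:E < T_0 w.1)%E] = c n * I n A.
    rewrite (cond_prob_excess P_levy (q_gt0 n) (u_cont _ (q_gt0 n))
      (u_dens _ (q_gt0 n)) x0 t0 (e_exp _ (q_gt0 n)) tA LA).
    by rewrite /c mulrAC.
  apply/andP; split; first by rewrite ler_wpM2l// mI.
  rewrite lerBrDr (le_trans _ (total n))// lerD2l ler_wpM2l// mI//.
  exact: measurableC.
- by apply: cvgM => //; exact: m_cvg.
- have -> : (h x)^-1 * j A = 1 - (h x)^-1 * j (~` A).
    have -> : j A = h x - j (~` A) by rewrite -jj addrK.
    by rewrite mulrBr mulVf// gt_eqF.
  apply: cvgB; first exact: cvg_cst.
  by apply: cvgM => //; apply: m_cvg; exact: measurableC.
Qed.
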